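(* The theory CZF + SC + UP proves that each of the following partially ordered structures is carried by a proper class (i.e. its carrier is not a set): (1) non-trivial $\bigvee$-semilattices and non-trivial $\bigwedge$-semilattices; (2) non-flat dcpo's; in particular, non-trivial dcpo's with a top or a bottom element; (3) non-flat bcpo's; in particular, non-trivial bcpo's with a top or a bottom element; (4) non-trivial chain-complete partially ordered classes. Consequently, no such structure can be proved to be carried by a set in CZF, or in any extension of CZF that is consistent with the conjunction of SC and UP.
   Context: CZF (Constructive Zermelo-Fraenkel set theory) is the theory in first-order intuitionistic logic with equality, in the language of $\in$, with axioms and schemes: Extensionality; Pair; Union; Restricted Separation ($\{y\in a : \phi(y)\}$ is a set for every set $a$ and every formula $\phi$ all of whose quantifiers are of the form $\forall x\in b$, $\exists x\in c$); Infinity; Set Induction ($\forall a((\forall x\in a)\phi(x)\to\phi(a))\to\forall a\,\phi(a)$, for all $\phi$); Strong Collection ($\forall a((\forall x\in a)\exists y\,\phi(x,y)\to\exists b((\forall x\in a)(\exists y\in b)\phi(x,y)\wedge(\forall y\in b)(\exists x\in a)\phi(x,y)))$, for all $\phi$); Subset Collection ($\forall a\forall b\exists c\forall u((\forall x\in a)(\exists y\in b)\phi(x,y,u)\to(\exists d\in c)((\forall x\in a)(\exists y\in d)\phi(x,y,u)\wedge(\forall y\in d)(\exists x\in a)\phi(x,y,u)))$, for all $\phi$). Formulas may contain parameters. Classes are given by formulas as usual; $\mathrm{Pow}(X)=\{x\mid x\subseteq X\}$ is the class of all subsets (which are sets) of $X$, and need not be a set. UP (uniformity principle) is the scheme: for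 every formula $\phi$, $(\forall x)(\exists y\in\mathbb N)\phi(x,y)\to(\exists y\in\mathbb N)(\forall x)\phi(x,y)$. SC (every set is subcountable) is: $(\forall x)(\exists U\in\mathrm{Pow}(\mathbb N))(\exists f)\ f:U\twoheadrightarrow x$, where $\twoheadrightarrow$ denotes a surjective map. It is known that CZF is consistent with the conjunction of UP and SC. A partially ordered class (poclass) $(X,\leq)$ is a class $X$ with a class relation $\leq$ that is reflexive, transitive and antisymmetric. ''Subset'' always means a subclass that is a set. A poclass $X$ is flat if $(\forall x,y\in X)(x\leq y\to x=y)$, and non-flat if it is not flat. A class $X$ is trivial if $(\exists x\in X)(\forall y\in X)(x=y)$, and non-trivial if it is not trivial. A poclass is: - a $\bigvee$-semilattice if every subset has a supremum; - a $\bigwedge$-semilattice if every subset has an infimum; - a dcpo if every directed subset has a join, where a subset $U$ is directed if it is inhabited and for all $x,y\in U$ there is $z\in U$ with $x,y\leq z$; - a bcpo (conditionally complete) if every inhabited and bounded subset has a join; - chain-complete if every chain, i.e. totally ordered subset, has a join. *)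

(* Defs.v *)
From Stdlib Require Import List Arith.
Import ListNotations.

(** De Bruijn indices are the only terms, so that substitution is renaming. *)

Inductive form : Type :=
| Bot
| Mem (x y : nat)
| Eq (x y : nat)
| And (p q : form)
| Or (p q : form)
| Imp (p q : form)
| All (p : form)
| Ex (p : form).

Definition scons (x : nat) (r : nat -> nat) : nat -> nat :=
  fun n => match n with 0 => x | S m => r m end.

Fixpoint ren (r : nat -> nat) (p : form) : form :=
  match p with
  | Bot => Bot
  | Mem x y => Mem (r x) (r y)
  | Eq x y => Eq (r x) (r y)
  | And p q => And (ren r p) (ren r q)
  | Or p q => Or (ren r p) (ren r q)
  | Imp p q => Imp (ren r p) (ren r q)
  | All p => All (ren (scons 0 (fun n => S (r n))) p)
  | Ex p => Ex (ren (scons 0 (fun n => S (r n))) p)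
  end.

Definition shift : form -> form := ren S.
Definition inst (x : nat) : form -> form := ren (scons x (fun n => n)).

(** The least [n] such that all free variables are below [n]. *)
Fixpoint fv_bound (p : form) : nat :=
  match p with
  | Bot => 0
  | Mem x y | Eq x y => Nat.max (S x) (S y)
  | And p q | Or p q | Imp p q => Nat.max (fv_bound p) (fv_bound q)
  | All p | Ex p => Nat.pred (fv_bound p)
  end.

Definition sentence (p : form) : Prop := fv_bound p = 0.
Definition all_closure (p : form) : form := Nat.iter (fv_bound p) All p.
Definition ex_closure (p : form) : form := Nat.iter (fv_bound p) Ex p.

Inductive derives : list form -> form -> Prop :=
| d_hyp G p : In p G -> derives G p
| d_bot_e G p : derives G Bot -> derives G p
| d_and_i G p q : derives G p -> derives G q -> derives G (And p q)
| d_and_e1 G p q : derives G (And p q) -> derives G p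
| d_and_e2 G p q : derives G (And p q) -> derives G q
| d_or_i1 G p q : derives G p -> derives G (Or p q)
| d_or_i2 G p q : derives G q -> derives G (Or p q)
| d_or_e G p q s :
    derives G (Or p q) -> derives (p :: G) s -> derives (q :: G) s -> derives G s
| d_imp_i G p q : derives (p :: G) q -> derives G (Imp p q)
| d_imp_e G p q : derives G (Imp p q) -> derives G p -> derives G q
| d_all_i G p : derives (map shift G) p -> derives G (All p)
| d_all_e G p x : derives G (All p) -> derives G (inst x p)
| d_ex_i G p x : derives G (inst x p) -> derives G (Ex p)
| d_ex_e G p s :
    derives G (Ex p) -> derives (p :: map shift G) (shift s) -> derives G s
| d_eq_refl G x : derives G (Eq x x)
| d_eq_e G p x y : derives G (Eq x y) -> derives G (inst x p) -> derives G (inst y p).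

Definition theory : Type := form -> Prop.

Definition proves (T : theory) (p : form) : Prop :=
  exists G, (forall q, In q G -> T q) /\ derives G p.

Definition consistent (T : theory) : Prop := ~ proves T Bot.

Definition union (T U : theory) : theory := fun p => T p \/ U p.

(** An [fm] is a formula to be placed under [d] binders, as a function of [d].
    A variable bound by the binder number [d0] (from the outside, starting at 0)
    has index [d - S d0] under [d] binders, while the free variable [k] of the
    ambient context becomes [d + k]. *)

Definition fm : Type := nat -> form.
Definition var : Type := nat -> nat.

Definition hBot : fm := fun _ => Bot.
Definition hMem (x y : var) : fm := fun d => Mem (x d) (y d).
Definition hEq (x y : var) : fm := fun d => Eq (x d) (y d).
Definition hAnd (p q : fm) : fm := fun d => And (p d) (q d).
Definition hOr (p q : fm) : fm := fun d => Or (p d) (q d).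
Definition hImp (p q : fm) : fm := fun d => Imp (p d) (q d).
Definition hAll (p : var -> fm) : fm := fun d => All (p (fun d' => d' - S d) (S d)).
Definition hEx (p : var -> fm) : fm := fun d => Ex (p (fun d' => d' - S d) (S d)).

Declare Scope fm_scope.
Delimit Scope fm_scope with fm.
Bind Scope fm_scope with fm.

Notation "⊥'" := hBot (at level 0) : fm_scope.
Notation "x ∈' y" := (hMem x y) (at level 70, no associativity) : fm_scope.
Notation "x ≡' y" := (hEq x y) (at level 70, no associativity) : fm_scope.
Notation "¬' p" := (hImp p hBot) (at level 75, right associativity) : fm_scope.
Notation "p ∧' q" := (hAnd p q) (at level 80, right associativity) : fm_scope.
Notation "p ∨' q" := (hOr p q) (at level 85, right associativity) : fm_scope.
Notation "p →' q" := (hImp p q) (at level 99, q at level 200, right associativity)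
  : fm_scope.
Notation "p ↔' q" := (hAnd (hImp p q) (hImp q p)) (at level 95, no associativity)
  : fm_scope.
Notation "∀' x .. y , p" := (hAll (fun x => .. (hAll (fun y => p%fm)) ..))
  (at level 200, x binder, y binder, right associativity) : fm_scope.
Notation "∃' x .. y , p" := (hEx (fun x => .. (hEx (fun y => p%fm)) ..))
  (at level 200, x binder, y binder, right associativity) : fm_scope.

(** [at_ p [x1; ..; xm]] puts [x1, .., xm] for the variables [0, .., m-1] of [p];
    the variables [m, m+1, ..] of [p] are its parameters, that is, the free
    variables [0, 1, ..] of the ambient context. *)
Definition at_ (p : form) (xs : list var) : fm :=
  fun d => ren (fold_right (fun x r => scons (x d) r) (fun k => d + k) xs) p.

Definition open_form (p : fm) : form := p 0.

Example open_form_ex (p : form) :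
  open_form (∀' a, ∃' b, ∀' y, y ∈' b →' y ∈' a ∧' at_ p [y])
  = All (Ex (All (Imp (Mem 0 1)
      (And (Mem 0 2) (ren (scons 0 (fun k => S (S (S k)))) p))))).
Proof. reflexivity. Qed.

Definition axiom (p : fm) : form := all_closure (open_form p).

(** [S b], not an arbitrary index: the bound of a quantifier is not its own variable. *)
Inductive restricted : form -> Prop :=
| r_bot : restricted Bot
| r_mem x y : restricted (Mem x y)
| r_eq x y : restricted (Eq x y)
| r_and p q : restricted p -> restricted q -> restricted (And p q)
| r_or p q : restricted p -> restricted q -> restricted (Or p q)
| r_imp p q : restricted p -> restricted q -> restricted (Imp p q)
| r_all b p : restricted p -> restricted (All (Imp (Mem 0 (S b)) p))
| r_ex b p : restricted p -> restricted (Ex (And (Mem 0 (S b)) p)).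

Local Open Scope fm_scope.

Definition is_empty (x : var) : fm := ∀' y, ¬' y ∈' x.
Definition is_succ (x y : var) : fm := ∀' z, z ∈' y ↔' (z ∈' x ∨' z ≡' x).
Definition is_omega (w : var) : fm :=
  ∀' x, x ∈' w ↔' (is_empty x ∨' ∃' y, y ∈' w ∧' is_succ y x).
Definition in_N (x : var) : fm := ∃' w, is_omega w ∧' x ∈' w.

Definition ax_extensionality : fm :=
  ∀' a b, (∀' x, x ∈' a ↔' x ∈' b) →' a ≡' b.
Definition ax_pair : fm :=
  ∀' a b, ∃' c, ∀' x, x ∈' c ↔' (x ≡' a ∨' x ≡' b).
Definition ax_union : fm :=
  ∀' a, ∃' c, ∀' x, x ∈' c ↔' (∃' y, y ∈' a ∧' x ∈' y).
Definition ax_separation (p : form) : fm :=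
  ∀' a, ∃' b, ∀' y, y ∈' b ↔' (y ∈' a ∧' at_ p [y]).
Definition ax_infinity : fm := ∃' w, is_omega w.
Definition ax_set_induction (p : form) : fm :=
  (∀' a, (∀' x, x ∈' a →' at_ p [x]) →' at_ p [a]) →' ∀' a, at_ p [a].

Definition full_on (a b : var) (R : var -> var -> fm) : fm :=
  (∀' x, x ∈' a →' ∃' y, y ∈' b ∧' R x y) ∧'
  (∀' y, y ∈' b →' ∃' x, x ∈' a ∧' R x y).

Definition ax_strong_collection (p : form) : fm :=
  ∀' a, (∀' x, x ∈' a →' ∃' y, at_ p [x; y]) →'
    ∃' b, full_on a b (fun x y => at_ p [x; y]).
Definition ax_subset_collection (p : form) : fm :=
  ∀' a b, ∃' c, ∀' u,
    (∀' x, x ∈' a →' ∃' y, y ∈' b ∧' at_ p [x; y; u]) →'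
    ∃' d, d ∈' c ∧' full_on a d (fun x y => at_ p [x; y; u]).

Inductive CZF : theory :=
| CZF_extensionality : CZF (axiom ax_extensionality)
| CZF_pair : CZF (axiom ax_pair)
| CZF_union : CZF (axiom ax_union)
| CZF_separation p : restricted p -> CZF (axiom (ax_separation p))
| CZF_infinity : CZF (axiom ax_infinity)
| CZF_set_induction p : CZF (axiom (ax_set_induction p))
| CZF_strong_collection p : CZF (axiom (ax_strong_collection p))
| CZF_subset_collection p : CZF (axiom (ax_subset_collection p)).

Inductive UP : theory :=
| UP_axiom p : UP (axiom (
    (∀' x, ∃' y, in_N y ∧' at_ p [x; y]) →'
    (∃' y, in_N y ∧' ∀' x, at_ p [x; y]))).

(** Kuratowski pairs: [is_upair p a b] is [p = {a,b}], [is_opair p a b] is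
    [p = {{a},{a,b}}]. *)
Definition is_upair (p a b : var) : fm := ∀' z, z ∈' p ↔' (z ≡' a ∨' z ≡' b).
Definition is_opair (p a b : var) : fm :=
  ∃' s t, is_upair s a a ∧' is_upair t a b ∧' is_upair p s t.
Definition maps_to (f a b : var) : fm := ∃' p, p ∈' f ∧' is_opair p a b.

Definition is_surjection (f U x : var) : fm :=
  (∀' p, p ∈' f →' ∃' n y, n ∈' U ∧' y ∈' x ∧' is_opair p n y) ∧'
  (∀' n, n ∈' U →' ∃' y, y ∈' x ∧' maps_to f n y) ∧'
  (∀' n y z, maps_to f n y →' maps_to f n z →' y ≡' z) ∧'
  (∀' y, y ∈' x →' ∃' n, n ∈' U ∧' maps_to f n y).

Inductive SC : theory :=
| SC_axiom : SC (axiom (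
    ∀' x, ∃' U, (∀' n, n ∈' U →' in_N n) ∧' ∃' f, is_surjection f U x)).

(** A class is given by a formula whose variable 0 is the element; a class relation
    by a formula whose variables 0 and 1 are the related elements.  The remaining
    variables are (common) parameters. *)

Section Poclass.

Variables X le : form.

Let inX (x : var) : fm := at_ X [x].
Let leq (x y : var) : fm := at_ le [x; y].

Definition carried_by_set : fm := ∃' a, ∀' x, x ∈' a ↔' inX x.

Definition poclass : fm :=
  (∀' x, inX x →' leq x x) ∧'
  (∀' x y z, inX x →' inX y →' inX z →' leq x y →' leq y z →' leq x z) ∧'
  (∀' x y, inX x →' inX y →' leq x y →' leq y x →' x ≡' y).

Definition flat : fm := ∀' x y, inX x →' inX y →' leq x y →' x ≡' y.
Definition trivial : fm := ∃' x, inX x ∧' ∀' y, inX y →' x ≡' y.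

Definition subset (u : var) : fm := ∀' x, x ∈' u →' inX x.
Definition upper_bound (u z : var) : fm := inX z ∧' ∀' x, x ∈' u →' leq x z.
Definition lower_bound (u z : var) : fm := inX z ∧' ∀' x, x ∈' u →' leq z x.
Definition has_sup (u : var) : fm :=
  ∃' s, upper_bound u s ∧' ∀' z, upper_bound u z →' leq s z.
Definition has_inf (u : var) : fm :=
  ∃' s, lower_bound u s ∧' ∀' z, lower_bound u z →' leq z s.

Definition inhabited_set (u : var) : fm := ∃' x, x ∈' u.
Definition directed (u : var) : fm :=
  inhabited_set u ∧'
  ∀' x y, x ∈' u →' y ∈' u →' ∃' z, z ∈' u ∧' leq x z ∧' leq y z.
Definition bounded (u : var) : fm := ∃' z, upper_bound u z.
Definition chain (u : var) : fm :=
  ∀' x y, x ∈' u →' y ∈' u →' leq x y ∨' leq y x.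

Definition has_top : fm := ∃' t, inX t ∧' ∀' x, inX x →' leq x t.
Definition has_bottom : fm := ∃' b, inX b ∧' ∀' x, inX x →' leq b x.

Definition sup_semilattice : fm := poclass ∧' ∀' u, subset u →' has_sup u.
Definition inf_semilattice : fm := poclass ∧' ∀' u, subset u →' has_inf u.
Definition dcpo : fm := poclass ∧' ∀' u, subset u →' directed u →' has_sup u.
Definition bcpo : fm :=
  poclass ∧' ∀' u, subset u →' inhabited_set u →' bounded u →' has_sup u.
Definition chain_complete : fm :=
  poclass ∧' ∀' u, subset u →' chain u →' has_sup u.

End Poclass.

Inductive kind : Type :=
| nontrivial_sup_semilattice
| nontrivial_inf_semilattice
| nonflat_dcpo
| nontrivial_dcpo_with_top_or_bottom
| nonflat_bcpo
| nontrivial_bcpo_with_top_or_bottom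
| nontrivial_chain_complete.

Definition structure (k : kind) (X le : form) : fm :=
  match k with
  | nontrivial_sup_semilattice => sup_semilattice X le ∧' ¬' trivial X
  | nontrivial_inf_semilattice => inf_semilattice X le ∧' ¬' trivial X
  | nonflat_dcpo => dcpo X le ∧' ¬' flat X le
  | nontrivial_dcpo_with_top_or_bottom =>
      dcpo X le ∧' ¬' trivial X ∧' (has_top X le ∨' has_bottom X le)
  | nonflat_bcpo => bcpo X le ∧' ¬' flat X le
  | nontrivial_bcpo_with_top_or_bottom =>
      bcpo X le ∧' ¬' trivial X ∧' (has_top X le ∨' has_bottom X le)
  | nontrivial_chain_complete => chain_complete X le ∧' ¬' trivial X
  end.

Definition proper_class_claim (k : kind) (X le : form) : form :=
  all_closure (open_form (structure k X le →' ¬' carried_by_set X)).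

Definition set_carrier_claim (k : kind) (X le : form) : form :=
  ex_closure (open_form (structure k X le ∧' carried_by_set X)).

(* Main.v *)
From Stdlib Require Import List Arith Lia Cantor.
From Stdlib Require Import Classical IndefiniteDescription FunctionalExtensionality.
Require Import Defs.
Import ListNotations.

(** SC and UP give a uniformity principle for every set [a]: if every [z] has some
    [y ∈ a] with [φ(z,y)], then a single [y ∈ a] works for all [z].  Given [x ≤ y] in a
    poclass carried by a set, apply this to the supremum of
    [{x} ∪ {y | x ∈ z}], a set which is a chain, directed, inhabited and bounded.  The
    supremum does not depend on [z], it is [x] for [z = ∅] and [y] for [z = {x}], so
    [x = y]: the poclass is flat.  A flat poclass with a top or a bottom is trivial.

    For the unprovability in CZF we need a model of CZF + SC + UP.  We take the
    realizability model in which a set is a partial family of sets indexed by realizers and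
    quantifiers are uniform: a realizer of [∀ x φ(x)] realizes every instance.  UP holds as a
    realizer of [y ∈ N] determines [y], and SC since the indices of a set are
    coded by numerals. *)

(** * Interpretations of formulas *)

(** SC enters through a map [f] from a set of natural numbers onto [a]: UP is applied to the numbers
    that name suitable elements of [a], and since [f] is single-valued, a common number names a
    common element. In the test set the membership of [y] depends on [x ∈ z]. Intuitionistically [z]
    may be any set, so the test sets form a family over the whole universe, which is the kind of
    family that UP makes constant. The order argument has to be a formal derivation; it is carried
    out in a sheaf model whose truth is derivability. In the realizability model a realizer of an
    existential statement contains no witness. Computational content comes from membership instead:
    its realizer starts with an index. Where the metatheory must still produce witnesses, as for
    Strong Collection, they are chosen. *)

Definition push {D : Type} (x : D) (r : nat -> D) : nat -> D :=
  fun n => match n with 0 => x | S m => r m end.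

(** [truth] is abstract: it is a sheaf in one model and a predicate on realizers in the other. Facts
    about [sem] are therefore equalities, which rest on functional extensionality. *)
Record interp := Interp {
  dom : Type;
  truth : Type;
  ibot : truth;
  imem : dom -> dom -> truth;
  ieq : dom -> dom -> truth;
  iand : truth -> truth -> truth;
  ior : truth -> truth -> truth;
  iimp : truth -> truth -> truth;
  iall : (dom -> truth) -> truth;
  iex : (dom -> truth) -> truth }.

Fixpoint sem (M : interp) (p : form) (r : nat -> dom M) : truth M :=
  match p with
  | Bot => ibot M
  | Mem x y => imem M (r x) (r y)
  | Eq x y => ieq M (r x) (r y)
  | And p q => iand M (sem M p r) (sem M q r)
  | Or p q => ior M (sem M p r) (sem M q r)
  | Imp p q => iimp M (sem M p r) (sem M q r)
  | All p => iall M (fun x => sem M p (push x r))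
  | Ex p => iex M (fun x => sem M p (push x r))
  end.

Lemma sem_ext_bound M p : forall r r',
  (forall n, n < fv_bound p -> r n = r' n) -> sem M p r = sem M p r'.
Proof.
  induction p; intros r r' H; cbn in *; auto;
    try (rewrite !H by lia; reflexivity);
    try (f_equal; [apply IHp1 | apply IHp2]; intros; apply H; lia);
    f_equal; apply functional_extensionality; intro x; apply IHp;
    intros [|n] Hn; cbn; auto; apply H; lia.
Qed.

Lemma sem_ren M p : forall s r, sem M (ren s p) r = sem M p (fun n => r (s n)).
Proof.
  induction p; intros s r; cbn; rewrite ?IHp1, ?IHp2; auto;
    f_equal; apply functional_extensionality; intro x; rewrite IHp;
    apply sem_ext_bound; intros [|n] _; reflexivity.
Qed.

Definition fv (i : nat) : var := fun d => d + i.

(** Evaluates [sem] on formulas written with the binder notations. Three splits of the environment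
    suffice, as [at_] receives at most three variables. *)
Ltac sem_eq :=
  cbn; unfold at_;
  repeat lazymatch goal with
    | |- ?P = ?P => reflexivity
    | |- sem ?M _ _ = sem _ _ _ =>
        rewrite !sem_ren; apply (sem_ext_bound M); intros [|[|[|?]]] _; reflexivity
    | |- (fun _ => _) = _ => apply functional_extensionality; intro
    | |- _ = _ => progress f_equal
    end.

(** * Renaming in formulas and derivations *)

Lemma ren_ext_bound p : forall r r',
  (forall n, n < fv_bound p -> r n = r' n) -> ren r p = ren r' p.
Proof.
  induction p; intros r r' H; cbn in *; auto;
    try (rewrite !H by lia; reflexivity);
    try (f_equal; [apply IHp1 | apply IHp2]; intros; apply H; lia);
    f_equal; apply IHp; intros [|n] Hn; cbn; auto; rewrite H by lia; auto.
Qed.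

Lemma ren_ren p : forall r s, ren s (ren r p) = ren (fun n => s (r n)) p.
Proof.
  induction p; intros r s; cbn; rewrite ?IHp1, ?IHp2; auto;
    f_equal; rewrite IHp; apply ren_ext_bound; intros [|n] _; reflexivity.
Qed.

Lemma ren_id p : forall r, (forall n, r n = n) -> ren r p = p.
Proof.
  induction p; intros r H; cbn; rewrite ?H; auto;
    try (rewrite IHp1, IHp2 by auto; reflexivity);
    rewrite IHp; auto; intros [|n]; cbn; auto.
Qed.

Lemma ren_sentence p r : sentence p -> ren r p = p.
Proof.
  intro H. rewrite <- (ren_id p (fun n => n)) at 2 by auto.
  apply ren_ext_bound. unfold sentence in H. intros; lia.
Qed.

Lemma sentence_all_closure p : sentence (all_closure p).
Proof.
  unfold sentence, all_closure.
  enough (forall n, fv_bound (Nat.iter n All p) = fv_bound p - n) as -> by lia.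
  induction n as [|n IH]; [now rewrite Nat.sub_0_r|].
  change (Nat.pred (fv_bound (Nat.iter n All p)) = fv_bound p - S n). lia.
Qed.

Lemma derives_weaken G p : derives G p -> forall G', incl G G' -> derives G' p.
Proof.
  induction 1; intros G' HG;
    try solve [econstructor; eauto using incl_cons, incl_tl, in_eq].
  - apply d_all_i, IHderives, incl_map, HG.
  - eapply d_ex_e; eauto. apply IHderives2, incl_cons; auto using in_eq, incl_tl, incl_map.
Qed.

Lemma ren_inst r x p : ren r (inst x p) = inst (r x) (ren (scons 0 (fun n => S (r n))) p).
Proof.
  unfold inst. rewrite !ren_ren. apply ren_ext_bound. intros [|n] _; reflexivity.
Qed.

Lemma ren_shift r p : ren (scons 0 (fun n => S (r n))) (shift p) = shift (ren r p).
Proof. unfold shift. rewrite !ren_ren. reflexivity. Qed.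

Lemma map_ren_shift r G :
  map (ren (scons 0 (fun n => S (r n)))) (map shift G) = map shift (map (ren r) G).
Proof. rewrite !map_map. apply map_ext. apply ren_shift. Qed.

Lemma derives_ren G p : derives G p -> forall r, derives (map (ren r) G) (ren r p).
Proof.
  induction 1; intro r; cbn in *; rewrite ?ren_inst;
    try solve [econstructor; eauto using in_map].
  - apply d_all_i. rewrite <- map_ren_shift. apply IHderives.
  - eapply d_ex_i. rewrite <- ren_inst. apply IHderives.
  - eapply d_ex_e; [apply IHderives1|].
    rewrite <- map_ren_shift, <- ren_shift. apply IHderives2.
  - eapply d_eq_e; [apply IHderives1|]. rewrite <- ren_inst. apply IHderives2.
Qed.

(** For fresh [x] this undoes [inst x]: the variable [x] becomes the bound variable 0 again. *)
Definition unbind (x : nat) : nat -> nat := fun n => if Nat.eqb n x then 0 else S n.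

Lemma ren_unbind_fresh x p : fv_bound p <= x -> ren (unbind x) p = shift p.
Proof.
  intro H. apply ren_ext_bound. intros n Hn. unfold unbind.
  destruct (Nat.eqb_spec n x); lia.
Qed.

Lemma ren_unbind_inst x p : Nat.pred (fv_bound p) <= x -> ren (unbind x) (inst x p) = p.
Proof.
  intro H. unfold inst. rewrite ren_ren. rewrite <- (ren_id p (fun n => n)) at 2 by auto.
  apply ren_ext_bound. intros [|n] Hn; cbn; unfold unbind.
  - now rewrite Nat.eqb_refl.
  - destruct (Nat.eqb_spec n x); lia.
Qed.

Lemma exists_fresh (G : list form) : exists x, forall p, In p G -> fv_bound p <= x.
Proof.
  exists (list_max (map fv_bound G)). intros p Hp.
  pose proof (proj1 (list_max_le (map fv_bound G) _) (le_n _)) as H.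
  rewrite Forall_forall in H. apply H, in_map, Hp.
Qed.

(** * The sheaf model of a theory *)

Section Deduction.
Variable T : theory.
Hypothesis T_sentence : forall p, T p -> sentence p.

(** The axioms are kept apart from the hypotheses [w]: being sentences they are fixed by every
    renaming, so the quantifier rules shift [w] only. *)
Definition ded (w : list form) (p : form) : Prop :=
  exists L, (forall q, In q L -> T q) /\ derives (L ++ w) p.

Lemma ded_mono w w' p : incl w w' -> ded w p -> ded w' p.
Proof.
  intros Hi (L & HL & H). exists L; split; auto.
  eapply derives_weaken; eauto using incl_app, incl_appl, incl_appr, incl_refl.
Qed.

Lemma ded_hyp w p : In p w -> ded w p.
Proof. intro H. exists []. split; [easy|]. now apply d_hyp. Qed.

Lemma ded_axiom w p : T p -> ded w p.
Proof.
  intro H. exists [p]. split; [intros q [<-|[]]; auto|]. apply d_hyp; now left.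
Qed.

Lemma ded_pure1 w p q :
  (forall G, derives G p -> derives G q) -> ded w p -> ded w q.
Proof. intros H (L & HL & Hp). exists L; auto. Qed.

Lemma ded_pure2 w p q s :
  (forall G, derives G p -> derives G q -> derives G s) -> ded w p -> ded w q -> ded w s.
Proof.
  intros H (L & HL & Hp) (K & HK & Hq). exists (L ++ K); split.
  - intros f Hf. apply in_app_or in Hf as []; auto.
  - apply H; eapply derives_weaken; eauto; rewrite <- app_assoc;
      apply incl_app; auto using incl_appl, incl_appr, incl_refl.
Qed.

Lemma ded_imp_i w p q : ded (p :: w) q -> ded w (Imp p q).
Proof.
  intros (L & HL & H). exists L; split; auto. apply d_imp_i.
  eapply derives_weaken; eauto. intros f Hf.
  apply in_app_or in Hf as [|[|]]; cbn; auto using in_or_app.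
Qed.

Lemma ded_or_e w p q s : ded w (Or p q) -> ded (p :: w) s -> ded (q :: w) s -> ded w s.
Proof.
  intros H Hp Hq. apply ded_imp_i in Hp, Hq.
  apply (ded_pure2 w (Imp p s) (Imp q s) (And (Imp p s) (Imp q s))) in Hq; auto using d_and_i.
  revert H Hq. apply ded_pure2. intros G H1 H2. eapply d_or_e; [exact H1| |].
  - eapply d_imp_e; [|apply d_hyp; now left].
    eapply d_and_e1, derives_weaken; eauto using incl_tl, incl_refl.
  - eapply d_imp_e; [|apply d_hyp; now left].
    eapply d_and_e2, derives_weaken; eauto using incl_tl, incl_refl.
Qed.

Lemma map_ren_sentences r L : (forall q, In q L -> T q) -> map (ren r) L = L.
Proof.
  intro H. rewrite <- (map_id L) at 2. apply map_ext_in. intros q Hq.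
  apply ren_sentence; auto.
Qed.

Lemma map_unbind_fresh x w :
  (forall p, In p w -> fv_bound p <= x) -> map (ren (unbind x)) w = map shift w.
Proof. intro H. apply map_ext_in. auto using ren_unbind_fresh. Qed.

(** The premise ranges over all [x], as the quantifier of the model does, but only its instance at a
    fresh [x] enters the derivation; likewise in [ded_ex_e]. *)
Lemma ded_all_i w p : (forall x, ded w (inst x p)) -> ded w (All p).
Proof.
  intro H. destruct (exists_fresh (All p :: w)) as [x Hx].
  destruct (H x) as (L & HL & Hd). exists L; split; auto. apply d_all_i.
  apply derives_ren with (r := unbind x) in Hd.
  rewrite ren_unbind_inst in Hd by (apply (Hx (All p)); now left).
  rewrite map_app, map_ren_sentences, map_unbind_fresh in Hd by (auto; intros; apply Hx; now right).
  unfold shift. rewrite map_app, map_ren_sentences; auto.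
Qed.

Lemma ded_ex_e w p s : ded w (Ex p) -> (forall x, ded (inst x p :: w) s) -> ded w s.
Proof.
  intros H Hs. destruct (exists_fresh (s :: Ex p :: w)) as [x Hx].
  specialize (Hs x). apply ded_imp_i in Hs. revert H Hs.
  intros (L & HL & Hd) (K & HK & He). exists (L ++ K); split.
  { intros f Hf. apply in_app_or in Hf as []; auto. }
  eapply d_ex_e.
  - eapply derives_weaken; [exact Hd|]. rewrite <- app_assoc.
    apply incl_app; auto using incl_appl, incl_appr, incl_refl.
  - apply derives_ren with (r := unbind x) in He. cbn in He.
    rewrite ren_unbind_inst, ren_unbind_fresh in He
      by ((apply (Hx (Ex p)) || apply Hx); cbn; auto).
    rewrite map_app, map_ren_sentences, map_unbind_fresh in He by (auto; intros; apply Hx; cbn; auto).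
    eapply d_imp_e; [|apply d_hyp; now left]. eapply derives_weaken; [exact He|].
    apply incl_tl. unfold shift. rewrite !map_app, !(map_ren_sentences _ K), <- app_assoc; auto.
    apply incl_appr, incl_refl.
Qed.

(** The worlds of the sheaf model are the finite contexts, and a context is covered by [S] if
    it derives everything that all its extensions in [S] derive.  Truth at a world is then
    derivability ([sem_syn]), so that a derivation in [T] can be given by reasoning in the
    model. *)
Definition cover (S : list form -> Prop) (w : list form) : Prop :=
  forall f w', incl w w' -> (forall w'', incl w' w'' -> S w'' -> ded w'' f) -> ded w' f.

Record sheaf := Sheaf {
  at_world :> list form -> Prop;
  sheaf_mono : forall w w', incl w w' -> at_world w -> at_world w';
  sheaf_cover : forall w, cover at_world w -> at_world w }.

Lemma cover_elim (P : sheaf) (S : list form -> Prop) w :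
  cover S w -> (forall w', incl w w' -> S w' -> P w') -> P w.
Proof.
  intros H HS. apply sheaf_cover. intros f w' Hi Hf. apply H; auto.
  intros w'' Hi' Hs. apply Hf; auto. apply HS; auto. eapply incl_tran; eauto.
Qed.

(** Sheafification. Falsity, disjunction and existence need it, because a union of sheaves need not
    be a sheaf. *)
Program Definition closure (S : list form -> Prop) : sheaf := Sheaf (cover S) _ _.
Next Obligation. intros f v Hv. apply H0. eapply incl_tran; eauto. Qed.
Next Obligation.
  intros f v Hv Hf. apply (H f v Hv). intros u Hu Hc.
  apply Hc; [apply incl_refl|]. intros. apply Hf; auto. eapply incl_tran; eauto.
Qed.

Lemma closure_intro (S : list form -> Prop) (w : list form) :
  (forall w', incl w w' -> S w -> S w') -> S w -> closure S w.
Proof. intros Hm H f v Hv Hf. apply Hf; auto using incl_refl. Qed.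

Program Definition sded (p : form) : sheaf := Sheaf (fun w => ded w p) _ _.
Next Obligation. eapply ded_mono; eauto. Qed.
Next Obligation. apply H; auto using incl_refl. Qed.

Program Definition sand (P Q : sheaf) : sheaf := Sheaf (fun w => P w /\ Q w) _ _.
Next Obligation. split; eapply sheaf_mono; eauto. Qed.
Next Obligation. split; eapply cover_elim; eauto; cbn; tauto. Qed.

Program Definition simp (P Q : sheaf) : sheaf :=
  Sheaf (fun w => forall w', incl w w' -> P w' -> Q w') _ _.
Next Obligation. apply H0; auto. eapply incl_tran; eauto. Qed.
Next Obligation.
  apply (sheaf_mono (closure (fun w => forall w', incl w w' -> P w' -> Q w'))) with (w' := w') in H; auto.
  eapply cover_elim; [exact H|]. cbn. intros v Hv HPQ. apply HPQ; auto using incl_refl.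
  eapply sheaf_mono; eauto.
Qed.

Program Definition sall {I} (P : I -> sheaf) : sheaf := Sheaf (fun w => forall i, P i w) _ _.
Next Obligation. eapply sheaf_mono; eauto. Qed.
Next Obligation. eapply cover_elim; eauto; cbn; auto. Qed.

Definition sex {I} (P : I -> sheaf) : sheaf := closure (fun w => exists i, P i w).
Definition sor (P Q : sheaf) : sheaf := closure (fun w => P w \/ Q w).
Definition sbot : sheaf := closure (fun _ => False).

Lemma sex_intro {I} (P : I -> sheaf) i w : P i w -> sex P w.
Proof.
  intro H. apply closure_intro; eauto. intros w' Hi [j Hj]. exists j. eapply sheaf_mono; eauto.
Qed.

Lemma sor_intro (P Q : sheaf) w : P w \/ Q w -> sor P Q w.
Proof.
  intro H. apply closure_intro; eauto. intros w' Hi [|]; [left|right]; eapply sheaf_mono; eauto.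
Qed.

Definition syn : interp :=
  Interp nat sheaf sbot (fun x y => sded (Mem x y)) (fun x y => sded (Eq x y))
    sand sor simp sall sex.

Lemma ren_push p x r : ren (push x r) p = inst x (ren (scons 0 (fun n => S (r n))) p).
Proof. unfold inst. rewrite ren_ren. apply ren_ext_bound. intros [|n] _; reflexivity. Qed.

(** For [Bot], [Or] and [Ex], one direction holds because derivability is itself a sheaf; in the
    other, the elimination rules say that the worlds deciding the formula form a cover. *)
Lemma sem_syn p : forall (r : nat -> nat) w, sem syn p r w <-> ded w (ren r p).
Proof.
  induction p; intros r w; cbn [sem syn ibot imem ieq iand ior iimp iall iex dom truth ren].
  - split.
    + intro H. apply (cover_elim (sded Bot) _ _ H). easy.
    + intro H. intros f v Hv _. apply (ded_pure1 _ Bot); [intro; apply d_bot_e|eapply ded_mono; eauto].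
  - reflexivity.
  - reflexivity.
  - cbn. rewrite IHp1, IHp2. split.
    + intros [H1 H2]. revert H1 H2. apply ded_pure2. intros G. apply d_and_i.
    + intro H; split; revert H; apply ded_pure1; intro G; [apply d_and_e1 | apply d_and_e2].
  - split.
    + intro H. apply (cover_elim (sded (Or _ _)) _ _ H). intros v Hv [H1|H1].
      * apply IHp1 in H1. revert H1. apply ded_pure1. intro G. apply d_or_i1.
      * apply IHp2 in H1. revert H1. apply ded_pure1. intro G. apply d_or_i2.
    + intros H f v Hv Hf. apply (ded_mono _ v) in H; auto. eapply ded_or_e; eauto; apply Hf;
      auto using incl_tl, incl_refl; [left; apply IHp1|right; apply IHp2]; apply ded_hyp; now left.
  - cbn. split.
    + intro H. apply ded_imp_i, IHp2, H; auto using incl_tl, incl_refl.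
      apply IHp1, ded_hyp; now left.
    + intros H v Hv H1. apply IHp2. apply IHp1 in H1. apply (ded_mono _ v) in H; auto.
      revert H H1. apply ded_pure2. intro G. apply d_imp_e.
  - cbn. split.
    + intro H. apply ded_all_i. intro x. rewrite <- ren_push. apply IHp, H.
    + intros H x. apply IHp. rewrite ren_push. revert H. apply ded_pure1. intro G. apply d_all_e.
  - split.
    + intro H. apply (cover_elim (sded (Ex _)) _ _ H). intros v Hv [x Hx].
      apply IHp in Hx. rewrite ren_push in Hx. revert Hx. apply ded_pure1. intro G. apply d_ex_i.
    + intros H f v Hv Hf. apply (ded_mono _ v) in H; auto. apply (ded_ex_e v _ f H).
      intro x. apply Hf; auto using incl_tl, incl_refl. exists x. apply IHp.
      rewrite (ren_push p x r). apply ded_hyp; now left.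
Qed.

End Deduction.

Lemma sex_elim {T I} (P : I -> sheaf T) (Q : sheaf T) w :
  sex T P w -> (forall w', incl w w' -> forall i, P i w' -> Q w') -> Q w.
Proof. intros H HQ. apply (cover_elim T Q _ w H). intros w' Hi [i Hp]. eauto. Qed.

Lemma sor_elim {T} (P P' Q : sheaf T) w :
  sor T P P' w -> (forall w', incl w w' -> P w' -> Q w') ->
  (forall w', incl w w' -> P' w' -> Q w') -> Q w.
Proof. intros H HP HP'. apply (cover_elim T Q _ w H). intros w' Hi []; eauto. Qed.

Lemma sbot_elim {T} (Q : sheaf T) w : sbot T w -> Q w.
Proof. intros H. apply (cover_elim T Q _ w H). easy. Qed.

Lemma simp_elim {T} (P Q : sheaf T) w : simp T P Q w -> P w -> Q w.
Proof. intros H HP. exact (H w (incl_refl _) HP). Qed.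

Lemma sem_iter_all T n p : forall (r r' : nat -> nat) w,
  (forall k, r' (n + k) = r k) -> sem (syn T) (Nat.iter n All p) r w -> sem (syn T) p r' w.
Proof.
  induction n; intros r r' w Hr H.
  - rewrite (sem_ext_bound (syn T) _ r' r); auto. intros; apply Hr.
  - apply (IHn (push (r' n) r)); [|exact (H (r' n))].
    intros [|k]; cbn; [f_equal; lia|]. rewrite <- Hr. f_equal; lia.
Qed.

Lemma sem_all_closure T p (r r' : nat -> nat) w :
  sem (syn T) (all_closure p) r w -> sem (syn T) p r' w.
Proof.
  (* The new environment is [r'] on the free variables of [p] and then continues with [r], on top of
     which the quantifiers are instantiated. *)
  intro H. rewrite (sem_ext_bound (syn T) _ r'
    (fun k => if k <? fv_bound p then r' k else r (k - fv_bound p))).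
  - eapply sem_iter_all; [|exact H]. intro k. cbn beta.
    destruct (Nat.ltb_spec (fv_bound p + k) (fv_bound p)); [lia|]. f_equal. lia.
  - intros k Hk. now apply Nat.ltb_lt in Hk as ->.
Qed.

Lemma sem_all_closure_intro T p w :
  (forall r, sem (syn T) p r w) -> forall r, sem (syn T) (all_closure p) r w.
Proof.
  unfold all_closure. intros H r. revert r. induction (fv_bound p); auto.
  intros r x. apply IHn.
Qed.

Lemma sem_ex_closure T p (Q : sheaf T) (r : nat -> nat) w :
  sem (syn T) (ex_closure p) r w ->
  (forall r' w', incl w w' -> sem (syn T) p r' w' -> Q w') -> Q w.
Proof.
  unfold ex_closure. revert r w. induction (fv_bound p); intros r w H HQ.
  - eauto using incl_refl.
  - eapply sex_elim; [exact H|]. cbn. intros w' Hi x Hx. eapply IHn; [exact Hx|].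
    intros r' w'' Hi'. apply HQ. eapply incl_tran; eauto.
Qed.

Lemma sem_axiom (T : theory) (T_sentence : forall p, T p -> sentence p) p (r : nat -> nat) w :
  T (axiom p) -> sem (syn T) (open_form p) r w.
Proof.
  intro H. apply (sem_all_closure _ _ r). apply sem_syn; auto.
  rewrite ren_sentence by auto. now apply ded_axiom.
Qed.

(** * The axioms of CZF + SC + UP as rules of the sheaf model *)

Definition base : theory := union CZF (union SC UP).

Lemma base_sentence p : base p -> sentence p.
Proof. intros [[]|[[]|[]]]; apply sentence_all_closure. Qed.

Notation "w ⊩ P" := (at_world base P w) (at level 70, no associativity).
Notation "P ∧s Q" := (sand base P Q) (at level 61, right associativity).
Notation "P ∨s Q" := (sor base P Q) (at level 62, right associativity).
Notation "P →s Q" := (simp base P Q) (at level 64, right associativity).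
Notation "P ↔s Q" := (sand base (simp base P Q) (simp base Q P)) (at level 63).
Notation "x ∈s y" := (sded base (Mem x y)) (at level 60).
Notation "x =s y" := (sded base (Eq x y)) (at level 60).
Notation "∀s x .. y , P" := (sall base (fun x => .. (sall base (fun y => P)) ..))
  (at level 65, x binder, y binder, right associativity).
Notation "∃s x .. y , P" := (sex base (fun x => .. (sex base (fun y => P)) ..))
  (at level 65, x binder, y binder, right associativity).
Notation bsem := (sem (syn base)).

(** Implication, existence and disjunction lead to a later world. All hypotheses are carried there
    by monotonicity and the old world is forgotten, so that proofs read like ordinary intuitionistic
    ones. *)
Ltac lift :=
  match goal with Hi : incl ?w ?w' |- _ =>
    repeat match goal with H : at_world base ?P w |- _ =>
      apply (sheaf_mono base P w w' Hi) in H end;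
    clear Hi; try clear w end.
Tactic Notation "simpl_intro" ident(H) := let w := fresh "w" in let Hi := fresh "Hi" in
  intros w Hi H; lift.
Tactic Notation "sdestruct" hyp(H) "as" ident(x) simple_intropattern(p) :=
  apply (sex_elim _ _ _ H); let w := fresh "w" in let Hi := fresh "Hi" in let Hx := fresh "Hx" in
  intros w Hi x Hx; try clear H; lift; revert Hx; intros p.
Tactic Notation "scase" hyp(H) "as" simple_intropattern(p) :=
  apply (sor_elim _ _ _ _ H); let w := fresh "w" in let Hi := fresh "Hi" in let Hx := fresh "Hx" in
  intros w Hi Hx; try clear H; lift; revert Hx; intros p.
Tactic Notation "sassert" ident(H) ":" constr(P) :=
  match goal with |- at_world base _ ?w => assert (H : w ⊩ P) end.
Tactic Notation "sassert" ident(H) ":" constr(P) "by" tactic3(t) :=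
  match goal with |- at_world base _ ?w => assert (H : w ⊩ P) by t end.

Definition sN (x : nat) : sheaf base :=
  bsem (open_form (in_N (fv 0))) (push x (fun _ => 0)).
Definition smaps (f n y : nat) : sheaf base :=
  bsem (open_form (maps_to (fv 0) (fv 1) (fv 2))) (push f (push n (push y (fun _ => 0)))).

Ltac axiom_instance H :=
  revert H;
  match goal with |- at_world _ ?P _ -> at_world _ ?Q _ =>
    let E := fresh in assert (E : P = Q) by (unfold sN, smaps; sem_eq); exact (fun H => eq_ind P (fun R => at_world base R _) H Q E) end.

Lemma up_rule p r w :
  w ⊩ (∀s x, ∃s y, sN y ∧s bsem p (push x (push y r))) ->
  w ⊩ (∃s y, sN y ∧s ∀s x, bsem p (push x (push y r))).
Proof.
  apply simp_elim.
  pose proof (sem_axiom base base_sentence _ r w (or_intror (or_intror (UP_axiom p)))) as H.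
  axiom_instance H.
Qed.

Lemma sep_rule p r w : restricted p ->
  w ⊩ (∀s a, ∃s b, ∀s y, y ∈s b ↔s (y ∈s a ∧s bsem p (push y r))).
Proof.
  intro Hp.
  pose proof (sem_axiom base base_sentence _ r w (or_introl (CZF_separation _ Hp))) as H.
  axiom_instance H.
Qed.

Lemma pair_rule w : w ⊩ (∀s a b, ∃s c, ∀s x, x ∈s c ↔s (x =s a ∨s x =s b)).
Proof.
  pose proof (sem_axiom base base_sentence _ (fun n => n) w (or_introl CZF_pair)) as H.
  axiom_instance H.
Qed.

Lemma sc_rule x w : w ⊩ (∃s f,
  (∀s y, y ∈s x →s ∃s n, sN n ∧s smaps f n y) ∧s
  (∀s n y z, smaps f n y →s smaps f n z →s y =s z)).
Proof.
  assert (H : w ⊩ (∀s x, ∃s U, (∀s n, n ∈s U →s sN n) ∧s ∃s f,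
    bsem (open_form (is_surjection (fv 0) (fv 1) (fv 2))) (push f (push U (push x (fun _ => 0)))))).
  { pose proof (sem_axiom base base_sentence _ (fun n => n) w (or_intror (or_introl SC_axiom))) as H.
    axiom_instance H. }
  specialize (H x). sdestruct H as U [HU Hf]. sdestruct Hf as f Hf.
  assert (E : bsem (open_form (is_surjection (fv 0) (fv 1) (fv 2))) (push f (push U (push x (fun _ => 0))))
   = ((∀s p, p ∈s f →s ∃s n y, n ∈s U ∧s y ∈s x ∧s
        bsem (open_form (is_opair (fv 0) (fv 1) (fv 2))) (push p (push n (push y (fun _ => 0))))) ∧s
      (∀s n, n ∈s U →s ∃s y, y ∈s x ∧s smaps f n y) ∧s
      (∀s n y z, smaps f n y →s smaps f n z →s y =s z) ∧s
      (∀s y, y ∈s x →s ∃s n, n ∈s U ∧s smaps f n y))) by (unfold smaps; sem_eq).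
  rewrite E in Hf. destruct Hf as [_ [_ [H1 H2]]].
  apply (sex_intro _ _ f). split; [|exact H1]. clear H1.
  intro y. simpl_intro Hy. pose proof (simp_elim _ _ _ (H2 y) Hy) as H.
  sdestruct H as n [Hn Hm]. apply (sex_intro _ _ n). split; [|exact Hm].
  exact (simp_elim _ _ _ (HU n) Hn).
Qed.

Lemma eq_rule p x y r w : w ⊩ (x =s y) -> w ⊩ bsem p (push x r) -> w ⊩ bsem p (push y r).
Proof.
  intros H Hx. apply sem_syn in Hx; [|exact base_sentence].
  apply sem_syn; [exact base_sentence|]. rewrite ren_push in Hx |- *.
  revert H Hx. apply ded_pure2. intro G. apply d_eq_e.
Qed.

Lemma seq_refl x w : w ⊩ (x =s x).
Proof. exists []. split; [easy|]. apply d_eq_refl. Qed.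

Lemma seq_sym x y w : w ⊩ (x =s y) -> w ⊩ (y =s x).
Proof.
  intro H. apply (eq_rule (Eq 0 1) x y (push x (fun n => n)) w H), seq_refl.
Qed.

(** UP is applied to the names [n], under the [f] of SC, of elements of [a]. The [n] common to all
    [z] names a single element because [f] is single-valued. *)
Lemma set_uniformity p r a w :
  w ⊩ (∀s z, ∃s y, y ∈s a ∧s bsem p (push z (push y r))) ->
  w ⊩ (∃s y, y ∈s a ∧s ∀s z, bsem p (push z (push y r))).
Proof.
  intro H. pose proof (sc_rule a w) as Hf. sdestruct Hf as f [Hsur Hfun].
  (* Under [Ex] the variables 0 to 4 are [y], [z], [n], [f], [a], and the parameters start at 5. *)
  set (q := Ex (And (Mem 0 4) (And (open_form (maps_to (fv 3) (fv 2) (fv 0)))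
    (ren (scons 1 (scons 0 (fun k => 5 + k))) p)))).
  assert (Hq : forall z n, bsem q (push z (push n (push f (push a r)))) =
      (∃s y, y ∈s a ∧s smaps f n y ∧s bsem p (push z (push y r)))).
  { intros z n. unfold q, smaps. sem_eq. }
  sassert H' : (∀s z, ∃s n, sN n ∧s bsem q (push z (push n (push f (push a r))))).
  { intro z. specialize (H z). sdestruct H as y [Hy Hp].
    pose proof (simp_elim _ _ _ (Hsur y) Hy) as H. sdestruct H as n [Hn Hm].
    apply (sex_intro _ _ n). split; [exact Hn|]. rewrite Hq.
    apply (sex_intro _ _ y). split; [exact Hy|]. split; [exact Hm|exact Hp]. }
  apply up_rule in H'. clear H. sdestruct H' as n [_ H].
  sassert H' : (∀s z, ∃s y, y ∈s a ∧s smaps f n y ∧s bsem p (push z (push y r))).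
  { intro z. rewrite <- Hq. exact (H z). }
  (* An arbitrary instance is enough to obtain the element named by [n]. *)
  clear H. pose proof (H' 0) as H. sdestruct H as y [Hy [Hm _]].
  apply (sex_intro _ _ y). split; [exact Hy|]. intro z.
  specialize (H' z). sdestruct H' as y' [_ [Hm' Hp]].
  sassert E : (y' =s y).
  { exact (simp_elim _ _ _ (simp_elim _ _ _ (Hfun n y' y) Hm') Hm). }
  (* [eq_rule] replaces variable 0 only, so the first two variables of [p] are exchanged. *)
  set (p' := ren (scons 1 (scons 0 (fun k => S (S k)))) p).
  assert (Hp' : forall u, bsem p' (push u (push z r)) = bsem p (push z (push u r))).
  { intro u. unfold p'. sem_eq. }
  rewrite <- Hp'. rewrite <- Hp' in Hp. exact (eq_rule _ _ _ _ _ E Hp).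
Qed.

(** * Posets carried by sets *)

Section Order.
Variables X le : form.
Variable r : nat -> nat.

Definition sX (x : nat) : sheaf base := bsem X (push x r).
Definition sle (x y : nat) : sheaf base := bsem le (push x (push y r)).

Definition spo : sheaf base :=
  (∀s x, sX x →s sle x x) ∧s
  (∀s x y z, sX x →s sX y →s sX z →s sle x y →s sle y z →s sle x z) ∧s
  (∀s x y, sX x →s sX y →s sle x y →s sle y x →s x =s y).
Definition ssubset (u : nat) : sheaf base := ∀s x, x ∈s u →s sX x.
Definition supper (u z : nat) : sheaf base := sX z ∧s ∀s x, x ∈s u →s sle x z.
Definition ssup (u s : nat) : sheaf base := supper u s ∧s ∀s z, supper u z →s sle s z.
Definition schain (u : nat) : sheaf base :=
  ∀s x y, x ∈s u →s y ∈s u →s sle x y ∨s sle y x.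
Definition sdirected (u : nat) : sheaf base :=
  (∃s x, x ∈s u) ∧s ∀s x y, x ∈s u →s y ∈s u →s ∃s z, z ∈s u ∧s sle x z ∧s sle y z.
Definition sflat : sheaf base := ∀s x y, sX x →s sX y →s sle x y →s x =s y.
Definition strivial : sheaf base := ∃s x, sX x ∧s ∀s y, sX y →s x =s y.
Definition scarried : sheaf base := ∃s a, ∀s x, x ∈s a ↔s sX x.

Definition stest (x y z u : nat) : sheaf base :=
  ∀s v, v ∈s u ↔s (v =s x ∨s (v =s y ∧s x ∈s z)).

(** What the various kinds of completeness have in common; [test_facts] supplies the properties of
    [u] that they ask for. *)
Definition stest_sups : sheaf base :=
  ∀s x y z u, sX x →s sX y →s sle x y →s stest x y z u →s ∃s s, ssup u s.

Lemma test_exists x y z w : w ⊩ (∃s u, stest x y z u).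
Proof.
  pose proof (pair_rule w x y) as H. sdestruct H as c Hc.
  (* The variables 0 to 3 are [v], [x], [y], [z]. *)
  set (q := Or (Eq 0 1) (And (Eq 0 2) (Mem 1 3))).
  assert (Hq : restricted q) by (repeat constructor).
  pose proof (sep_rule q (push x (push y (push z r))) w0 Hq c) as H.
  sdestruct H as u Hu. apply (sex_intro _ _ u). intro v. specialize (Hu v) as [H1 H2].
  split.
  - simpl_intro Hv. exact (proj2 (simp_elim _ _ _ H1 Hv)).
  - simpl_intro Hv. apply (simp_elim _ _ _ H2). split; [|exact Hv].
    apply (simp_elim _ _ _ (proj2 (Hc v))).
    scase Hv as Hv; apply sor_intro; [left; exact Hv|right; exact (proj1 Hv)].
Qed.

Lemma sX_eq x y w : w ⊩ (x =s y) -> w ⊩ sX y -> w ⊩ sX x.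
Proof. intros H. apply (eq_rule X). now apply seq_sym. Qed.

Lemma sle_eq_l x y z w : w ⊩ (x =s y) -> w ⊩ sle y z -> w ⊩ sle x z.
Proof. intros H. apply (eq_rule le). now apply seq_sym. Qed.

Lemma sle_eq_r x y z w : w ⊩ (x =s y) -> w ⊩ sle z y -> w ⊩ sle z x.
Proof.
  intros H Hz. set (le' := ren (scons 1 (scons 0 (fun k => S (S k)))) le).
  assert (E : forall u, bsem le' (push u (push z r)) = sle z u).
  { intro u. unfold le', sle. sem_eq. }
  rewrite <- E. rewrite <- E in Hz. eapply eq_rule; [|exact Hz]. now apply seq_sym.
Qed.

(** The variables 0, 1, 2, 3 stand for [z], [s], [x], [y]; the parameters of [X] and [le]
    start at 4. *)
Definition sup_form : form :=
  let X' := ren (scons 0 (fun k => 5 + k)) X in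
  let le' := ren (scons 0 (scons 1 (fun k => 6 + k))) le in
  open_form (∃' u,
    (∀' v, v ∈' u ↔' (v ≡' fv 2 ∨' (v ≡' fv 3 ∧' fv 2 ∈' fv 0))) ∧'
    upper_bound X' le' u (fv 1) ∧' ∀' t, upper_bound X' le' u t →' at_ le' [fv 1; t])%fm.

Lemma sem_sup_form x y z s :
  bsem sup_form (push z (push s (push x (push y r)))) = ∃s u, stest x y z u ∧s ssup u s.
Proof. unfold sup_form, stest, ssup, supper, sX, sle. sem_eq. Qed.

Lemma empty_exists w : w ⊩ (∃s z, ∀s x, x ∈s z →s sbot base).
Proof.
  pose proof (sep_rule Bot r w r_bot 0) as H. sdestruct H as z Hz.
  apply (sex_intro _ _ z). intro x. simpl_intro Hx.
  exact (proj2 (simp_elim _ _ _ (proj1 (Hz x)) Hx)).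
Qed.

Lemma simp2 (P Q S : sheaf base) w : w ⊩ (P →s Q →s S) -> w ⊩ P -> w ⊩ Q -> w ⊩ S.
Proof. intros H HP HQ. exact (simp_elim _ _ _ (simp_elim _ _ _ H HP) HQ). Qed.

(** That a set [a] carries [X] puts the suprema into [a], as [set_uniformity] demands. From the
    common supremum [s] only [y ≤ s] and [s ≤ x] are extracted, and antisymmetry concludes. *)
Lemma flat_of_test_sups w :
  w ⊩ spo -> w ⊩ scarried -> w ⊩ stest_sups -> w ⊩ sflat.
Proof.
  intros [Hrefl [Htrans Hanti]] Ha Hsup. sdestruct Ha as a Ha.
  intros x y. simpl_intro Hx. simpl_intro Hy. simpl_intro Hxy.
  assert (Hxx := simp_elim _ _ _ (Hrefl x) Hx).
  sassert H : (∀s z, ∃s s, s ∈s a ∧s bsem sup_form (push z (push s (push x (push y r))))).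
  { intro z. pose proof (test_exists x y z w) as H. sdestruct H as u Hu.
    pose proof (simp_elim _ _ _ (simp2 _ _ _ _ (simp_elim _ _ _ (Hsup x y z u) Hx) Hy Hxy) Hu) as H.
    sdestruct H as s Hs. apply (sex_intro _ _ s). split.
    - exact (simp_elim _ _ _ (proj2 (Ha s)) (proj1 (proj1 Hs))).
    - rewrite sem_sup_form. apply (sex_intro _ _ u). split; assumption. }
  apply set_uniformity in H. sdestruct H as s [Hsa Hs].
  assert (HsX := simp_elim _ _ _ (proj1 (Ha s)) Hsa).
  (* For empty [z] the test set has no element but [x], so [x] is an upper bound. *)
  sassert Hsx : (sle s x).
  { pose proof (empty_exists w0) as H. sdestruct H as z Hz.
    sassert H : (∃s u, stest x y z u ∧s ssup u s) by (rewrite <- sem_sup_form; exact (Hs z)). sdestruct H as u [Hu [_ Hl]].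
    apply (simp_elim _ _ _ (Hl x)). split; [exact Hx|]. intro v. simpl_intro Hv.
    pose proof (simp_elim _ _ _ (proj1 (Hu v)) Hv) as H. scase H as Hv'.
    - exact (sle_eq_l _ _ _ _ Hv' Hxx).
    - apply sbot_elim. exact (simp_elim _ _ _ (Hz x) (proj2 Hv')). }
  (* For [z = {x}] the test set contains [y]. *)
  sassert Hys : (sle y s).
  { pose proof (pair_rule w0 x x) as H. sdestruct H as z Hz.
    sassert H : (∃s u, stest x y z u ∧s ssup u s) by (rewrite <- sem_sup_form; exact (Hs z)). sdestruct H as u [Hu [[_ Hl] _]].
    apply (simp_elim _ _ _ (Hl y)). apply (simp_elim _ _ _ (proj2 (Hu y))).
    apply sor_intro; right. split; [apply seq_refl|].
    apply (simp_elim _ _ _ (proj2 (Hz x))). apply sor_intro; left. apply seq_refl. }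
  apply (simp_elim _ _ _ (simp2 _ _ _ _ (simp_elim _ _ _ (Hanti x y) Hx) Hy Hxy)).
  apply (fun H => simp2 _ _ _ _ H Hys Hsx).
  exact (simp2 _ _ _ _ (simp_elim _ _ _ (Htrans y s x) Hy) HsX Hx).
Qed.

(** Elements of [u] equal [x] or [y], so [x] is below and [y] above all of [u]. Two elements are
    thus comparable as soon as one of them is identified, and an inhabited chain is directed. *)
Lemma test_facts x y z u w :
  w ⊩ spo -> w ⊩ sX x -> w ⊩ sX y -> w ⊩ sle x y -> w ⊩ stest x y z u ->
  w ⊩ (ssubset u ∧s schain u ∧s sdirected u ∧s supper u y).
Proof.
  intros [Hrefl _] Hx Hy Hxy Hu.
  assert (Hxx := simp_elim _ _ _ (Hrefl x) Hx).
  assert (Hyy := simp_elim _ _ _ (Hrefl y) Hy).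
  sassert Hc : (∀s v, v ∈s u →s v =s x ∨s v =s y).
  { intro v. simpl_intro Hv. pose proof (simp_elim _ _ _ (proj1 (Hu v)) Hv) as H.
    scase H as H; apply sor_intro; [left; exact H|right; exact (proj1 H)]. }
  sassert HuX : (ssubset u).
  { intro v. simpl_intro Hv. pose proof (simp_elim _ _ _ (Hc v) Hv) as H.
    scase H as H; eapply sX_eq; eassumption. }
  sassert Huy : (∀s v, v ∈s u →s sle v y).
  { intro v. simpl_intro Hv. pose proof (simp_elim _ _ _ (Hc v) Hv) as H.
    scase H as H; eapply sle_eq_l; eassumption. }
  sassert Hxu : (∀s v, v ∈s u →s sle x v).
  { intro v. simpl_intro Hv. pose proof (simp_elim _ _ _ (Hc v) Hv) as H.
    scase H as H; eapply sle_eq_r; eassumption. }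
  sassert Hch : (schain u).
  { intros v v'. simpl_intro Hv. simpl_intro Hv'.
    pose proof (simp_elim _ _ _ (Hc v) Hv) as H. scase H as H; apply sor_intro.
    - left. apply (sle_eq_l _ _ _ _ H). exact (simp_elim _ _ _ (Hxu v') Hv').
    - right. apply (sle_eq_r _ _ _ _ H). exact (simp_elim _ _ _ (Huy v') Hv'). }
  split; [exact HuX|]. split; [exact Hch|]. split; [split|split].
  - apply (sex_intro _ _ x). apply (simp_elim _ _ _ (proj2 (Hu x))).
    apply sor_intro; left. apply seq_refl.
  - intros v v'. simpl_intro Hv. simpl_intro Hv'.
    pose proof (simp_elim _ _ _ (Hrefl v) (simp_elim _ _ _ (HuX v) Hv)) as Hvv.
    pose proof (simp_elim _ _ _ (Hrefl v') (simp_elim _ _ _ (HuX v') Hv')) as Hvv'.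
    pose proof (simp2 _ _ _ _ (Hch v v') Hv Hv') as H. scase H as H.
    + apply (sex_intro _ _ v'). split; [exact Hv'|]. split; assumption.
    + apply (sex_intro _ _ v). split; [exact Hv|]. split; assumption.
  - exact Hy.
  - exact Huy.
Qed.

Lemma trivial_of_bottom w :
  w ⊩ sflat -> w ⊩ (∃s b, sX b ∧s ∀s x, sX x →s sle b x) -> w ⊩ strivial.
Proof.
  intros Hf H. sdestruct H as b [Hb Hle]. apply (sex_intro _ _ b). split; [exact Hb|].
  intro x. simpl_intro Hx. apply (simp_elim _ _ _ (simp2 _ _ _ _ (Hf b x) Hb Hx)).
  exact (simp_elim _ _ _ (Hle x) Hx).
Qed.

Lemma trivial_of_top w :
  w ⊩ sflat -> w ⊩ (∃s t, sX t ∧s ∀s x, sX x →s sle x t) -> w ⊩ strivial.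
Proof.
  intros Hf H. sdestruct H as t [Ht Hle]. apply (sex_intro _ _ t). split; [exact Ht|].
  intro x. simpl_intro Hx. apply seq_sym.
  apply (simp_elim _ _ _ (simp2 _ _ _ _ (Hf x t) Hx Ht)).
  exact (simp_elim _ _ _ (Hle x) Hx).
Qed.

Lemma bottom_of_empty_sup w :
  w ⊩ (∀s u, ssubset u →s schain u →s ∃s s, ssup u s) ->
  w ⊩ (∃s b, sX b ∧s ∀s x, sX x →s sle b x).
Proof.
  intro Hsup. pose proof (empty_exists w) as H. sdestruct H as u Hu.
  sassert H : (∃s s, ssup u s).
  { apply (simp2 _ _ _ _ (Hsup u)).
    - intro x. simpl_intro Hx. apply sbot_elim. exact (simp_elim _ _ _ (Hu x) Hx).
    - intros x y. simpl_intro Hx. apply sbot_elim. exact (simp_elim _ _ _ (Hu x) Hx). }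
  sdestruct H as s [[Hs _] Hl]. apply (sex_intro _ _ s). split; [exact Hs|].
  intro x. simpl_intro Hx. apply (simp_elim _ _ _ (Hl x)). split; [exact Hx|].
  intro v. simpl_intro Hv. apply sbot_elim. exact (simp_elim _ _ _ (Hu v) Hv).
Qed.

End Order.

(** * The structures of the theorem, read in the sheaf model *)

Section Kinds.
Variables X le : form.
Variable r : nat -> nat.

Ltac unfold_order :=
  unfold spo, ssubset, ssup, supper, schain, sdirected, sflat, strivial, scarried, sX, sle; sem_eq.

Lemma sem_carried : bsem (open_form (carried_by_set X)) r = scarried X r.
Proof. unfold_order. Qed.

Lemma sem_trivial : bsem (open_form (trivial X)) r = strivial X r.
Proof. unfold_order. Qed.

Lemma sem_flat : bsem (open_form (flat X le)) r = sflat X le r.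
Proof. unfold_order. Qed.

Lemma sem_top :
  bsem (open_form (has_top X le)) r = ∃s t, sX X r t ∧s ∀s x, sX X r x →s sle le r x t.
Proof. unfold_order. Qed.

Lemma sem_bottom :
  bsem (open_form (has_bottom X le)) r = ∃s b, sX X r b ∧s ∀s x, sX X r x →s sle le r b x.
Proof. unfold_order. Qed.

Lemma sem_sup_semilattice :
  bsem (open_form (sup_semilattice X le)) r =
  spo X le r ∧s ∀s u, ssubset X r u →s ∃s s, ssup X le r u s.
Proof. unfold_order. Qed.

Lemma sem_dcpo :
  bsem (open_form (dcpo X le)) r =
  spo X le r ∧s ∀s u, ssubset X r u →s sdirected le r u →s ∃s s, ssup X le r u s.
Proof. unfold_order. Qed.

Lemma sem_bcpo :
  bsem (open_form (bcpo X le)) r =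
  spo X le r ∧s ∀s u, ssubset X r u →s (∃s x, x ∈s u) →s (∃s z, supper X le r u z) →s
    ∃s s, ssup X le r u s.
Proof. unfold_order. Qed.

Lemma sem_chain_complete :
  bsem (open_form (chain_complete X le)) r =
  spo X le r ∧s ∀s u, ssubset X r u →s schain le r u →s ∃s s, ssup X le r u s.
Proof. unfold_order. Qed.

(** Infima are suprema of the opposite order, which reduces the second kind of semilattice to the
    first. *)
Definition flip_rel : form := ren (scons 1 (scons 0 (fun k => S (S k)))) le.

Lemma sle_flip x y : sle flip_rel r x y = sle le r y x.
Proof. unfold flip_rel, sle. sem_eq. Qed.

Lemma sem_inf_semilattice w :
  w ⊩ bsem (open_form (inf_semilattice X le)) r ->
  w ⊩ (spo X flip_rel r ∧s ∀s u, ssubset X r u →s ∃s s, ssup X flip_rel r u s).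
Proof.
  assert (E : bsem (open_form (inf_semilattice X le)) r =
    (spo X le r ∧s ∀s u, ssubset X r u →s ∃s s, ssup X flip_rel r u s))
    by (unfold flip_rel; unfold_order).
  rewrite E. intros [[Hrefl [Htrans Hanti]] Hsup]. split; [|exact Hsup].
  split; [|split].
  - intro x. rewrite sle_flip. exact (Hrefl x).
  - intros x y z. simpl_intro Hx. simpl_intro Hy. simpl_intro Hz. rewrite !sle_flip.
    simpl_intro Hxy. simpl_intro Hyz. apply (fun H => simp2 _ _ _ _ H Hyz Hxy).
    exact (simp_elim _ _ _ (simp2 _ _ _ _ (Htrans z y x) Hz Hy) Hx).
  - intros x y. simpl_intro Hx. simpl_intro Hy. rewrite !sle_flip.
    simpl_intro Hxy. simpl_intro Hyx.
    exact (simp2 _ _ _ _ (simp2 _ _ _ _ (Hanti x y) Hx Hy) Hyx Hxy).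
Qed.
End Kinds.

Lemma flat_dcpo X le r w :
  w ⊩ spo X le r -> w ⊩ scarried X r ->
  w ⊩ (∀s u, ssubset X r u →s sdirected le r u →s ∃s s, ssup X le r u s) -> w ⊩ sflat X le r.
Proof.
  intros Hpo Hc Hsup. apply flat_of_test_sups; auto. intros x y z u.
  simpl_intro Hx. simpl_intro Hy. simpl_intro Hxy. simpl_intro Hu.
  destruct (test_facts _ _ _ _ _ _ _ _ Hpo Hx Hy Hxy Hu) as [H1 [_ [H2 _]]].
  exact (simp2 _ _ _ _ (Hsup u) H1 H2).
Qed.

Lemma flat_bcpo X le r w :
  w ⊩ spo X le r -> w ⊩ scarried X r ->
  w ⊩ (∀s u, ssubset X r u →s (∃s x, x ∈s u) →s (∃s z, supper X le r u z) →s
    ∃s s, ssup X le r u s) -> w ⊩ sflat X le r.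
Proof.
  intros Hpo Hc Hsup. apply flat_of_test_sups; auto. intros x y z u.
  simpl_intro Hx. simpl_intro Hy. simpl_intro Hxy. simpl_intro Hu.
  destruct (test_facts _ _ _ _ _ _ _ _ Hpo Hx Hy Hxy Hu) as [H1 [_ [[H2 _] H3]]].
  apply (simp_elim _ _ _ (simp2 _ _ _ _ (Hsup u) H1 H2)). exact (sex_intro _ _ y _ H3).
Qed.

Lemma trivial_chain_complete X le r w :
  w ⊩ spo X le r -> w ⊩ scarried X r ->
  w ⊩ (∀s u, ssubset X r u →s schain le r u →s ∃s s, ssup X le r u s) -> w ⊩ strivial X r.
Proof.
  intros Hpo Hc Hsup. apply (trivial_of_bottom X le); [|apply bottom_of_empty_sup; exact Hsup].
  apply flat_of_test_sups; auto. intros x y z u.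
  simpl_intro Hx. simpl_intro Hy. simpl_intro Hxy. simpl_intro Hu.
  destruct (test_facts _ _ _ _ _ _ _ _ Hpo Hx Hy Hxy Hu) as [H1 [H2 _]].
  exact (simp2 _ _ _ _ (Hsup u) H1 H2).
Qed.

Lemma trivial_semilattice X le r w :
  w ⊩ spo X le r -> w ⊩ scarried X r ->
  w ⊩ (∀s u, ssubset X r u →s ∃s s, ssup X le r u s) -> w ⊩ strivial X r.
Proof.
  intros Hpo Hc Hsup. apply (trivial_chain_complete X le); auto.
  intro u. simpl_intro Hu. simpl_intro Hch. exact (simp_elim _ _ _ (Hsup u) Hu).
Qed.

Lemma trivial_of_extremum X le r w :
  w ⊩ sflat X le r ->
  w ⊩ sor base (bsem (open_form (has_top X le)) r) (bsem (open_form (has_bottom X le)) r) ->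
  w ⊩ strivial X r.
Proof.
  rewrite sem_top, sem_bottom. intros Hf H. scase H as H.
  - eapply trivial_of_top; eassumption.
  - eapply trivial_of_bottom; eassumption.
Qed.

Lemma sem_hAnd p q r : bsem (open_form (hAnd p q)) r = bsem (open_form p) r ∧s bsem (open_form q) r.
Proof. reflexivity. Qed.

Lemma sem_hImp p q r : bsem (open_form (hImp p q)) r = bsem (open_form p) r →s bsem (open_form q) r.
Proof. reflexivity. Qed.

Lemma structure_not_carried k X le r w :
  w ⊩ bsem (open_form (structure k X le →' ¬' carried_by_set X)%fm) r.
Proof.
  rewrite !sem_hImp, sem_carried. simpl_intro H. simpl_intro Hc.
  destruct k; cbn [structure] in H; rewrite ?sem_hAnd, sem_hImp in H.
  - rewrite sem_sup_semilattice, sem_trivial in H. destruct H as [[Hpo Hsup] Hn].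
    apply (simp_elim _ _ _ Hn). eapply trivial_semilattice; eassumption.
  - destruct H as [H Hn]. destruct (sem_inf_semilattice _ _ _ _ H) as [Hpo Hsup].
    rewrite sem_trivial in Hn. apply (simp_elim _ _ _ Hn).
    eapply trivial_semilattice; eassumption.
  - rewrite sem_dcpo, sem_flat in H. destruct H as [[Hpo Hsup] Hn].
    apply (simp_elim _ _ _ Hn). apply flat_dcpo; assumption.
  - rewrite sem_dcpo, sem_trivial in H. destruct H as [[Hpo Hsup] [Hn He]].
    apply (simp_elim _ _ _ Hn). eapply trivial_of_extremum; [|exact He].
    apply flat_dcpo; assumption.
  - rewrite sem_bcpo, sem_flat in H. destruct H as [[Hpo Hsup] Hn].
    apply (simp_elim _ _ _ Hn). apply flat_bcpo; assumption.
  - rewrite sem_bcpo, sem_trivial in H. destruct H as [[Hpo Hsup] [Hn He]].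
    apply (simp_elim _ _ _ Hn). eapply trivial_of_extremum; [|exact He].
    apply flat_bcpo; assumption.
  - rewrite sem_chain_complete, sem_trivial in H. destruct H as [[Hpo Hsup] Hn].
    apply (simp_elim _ _ _ Hn). eapply trivial_chain_complete; eassumption.
Qed.

Lemma proper_class k X le : proves base (proper_class_claim k X le).
Proof.
  enough (H : ded base [] (proper_class_claim k X le)).
  { destruct H as (L & HL & H). exists L. split; [exact HL|]. now rewrite app_nil_r in H. }
  rewrite <- (ren_id (proper_class_claim k X le) (fun n => n)) by reflexivity.
  apply sem_syn; [exact base_sentence|]. apply sem_all_closure_intro.
  intro r. apply structure_not_carried.
Qed.

(** [T'] proves the axioms of [base], hence by cut the claim of properness, which contradicts a set
    carrier. *)
Lemma no_set_carrier (T : theory) :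
  (forall p, T p -> sentence p) -> (forall p, CZF p -> proves T p) ->
  consistent (union T (union SC UP)) ->
  forall k X le, ~ proves T (set_carrier_claim k X le).
Proof.
  intros HT HCZF Hcon k X le (G & HG & HGd). apply Hcon.
  set (T' := union T (union SC UP)).
  assert (HT' : forall p, T' p -> sentence p).
  { intros p [H|H]; [auto|apply base_sentence; now right]. }
  assert (Hbase : forall p, base p -> ded T' [] p).
  { intros p [H|H].
    - destruct (HCZF p H) as (L & HL & Hd). exists L. split; [intros; left; auto|].
      now rewrite app_nil_r.
    - apply ded_axiom. now right. }
  assert (Hcut : forall L p, (forall q, In q L -> ded T' [] q) -> ded T' L p -> ded T' [] p).
  { induction L as [|q L IH]; intros p HL Hp; auto.
    apply ded_imp_i in Hp. apply IH in Hp; [|intros; apply HL; now right].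
    assert (Hq := HL q (or_introl eq_refl)). revert Hp Hq. apply ded_pure2.
    intro. apply d_imp_e. }
  assert (H1 : ded T' [] (proper_class_claim k X le)).
  { destruct (proper_class k X le) as (L & HL & Hd). apply (Hcut L); auto.
    exists []. split; [easy|exact Hd]. }
  assert (H2 : ded T' [] (set_carrier_claim k X le)).
  { exists G. split; [intros; left; auto|]. now rewrite app_nil_r. }
  assert (H : ded T' [] Bot).
  { rewrite <- (ren_id _ (fun n => n)) in H1 by reflexivity.
    rewrite <- (ren_id _ (fun n => n)) in H2 by reflexivity.
    apply sem_syn in H1, H2; auto.
    apply (sem_syn T' HT' Bot (fun n => n)).
    (* The parameters [r'] provided by the existential closure instantiate the universal one. *)
    apply (sem_ex_closure T' _ (sbot T') _ _ H2). intros r' w Hi [Hs Hc].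
    apply (sem_all_closure _ _ _ r') in H1.
    exact (H1 w Hi Hs w (incl_refl _) Hc). }
  destruct H as (L & HL & Hd). exists L. split; auto. now rewrite app_nil_r in Hd.
Qed.

(** * Realizers *)

(** A call-by-value language whose programs run in an environment, itself a value: [Env]
    returns it, [Lam] and [Rec] push the argument (and the closure) onto it.  [Quote] makes the
    coding of values by numerals computable, as SC requires. *)
Inductive tm : Type :=
| Env
| Unit
| Lam (t : tm)
| Rec (t : tm)
| App (t u : tm)
| MkPair (t u : tm)
| Fst (t : tm)
| Snd (t : tm)
| Inl (t : tm)
| Inr (t : tm)
| Case (t u v : tm)
| Quote (t : tm).

Inductive val : Type :=
| vtt
| vpair (a b : val)
| vinl (a : val)
| vinr (a : val)
| vclo (t : tm) (e : val)
| vrec (t : tm) (e : val).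

(** Opaque, so that [code2] never unfolds to Cantor's function and only its injectivity is
    visible. *)
Lemma pairing :
  {c : nat -> nat -> nat | forall m n m' n', c m n = c m' n' -> m = m' /\ n = n'}.
Proof.
  exists (fun m n => to_nat (m, n)). intros m n m' n' H.
  apply (f_equal of_nat) in H. rewrite !cancel_of_to in H. now injection H.
Qed.

Definition code2 : nat -> nat -> nat := proj1_sig pairing.

Fixpoint tm_code (t : tm) : nat :=
  match t with
  | Env => code2 0 0
  | Unit => code2 1 0
  | Lam t => code2 2 (tm_code t)
  | Rec t => code2 3 (tm_code t)
  | App t u => code2 4 (code2 (tm_code t) (tm_code u))
  | MkPair t u => code2 5 (code2 (tm_code t) (tm_code u))
  | Fst t => code2 6 (tm_code t)
  | Snd t => code2 7 (tm_code t)
  | Inl t => code2 8 (tm_code t)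
  | Inr t => code2 9 (tm_code t)
  | Case t u v => code2 10 (code2 (tm_code t) (code2 (tm_code u) (tm_code v)))
  | Quote t => code2 11 (tm_code t)
  end.

Fixpoint val_code (a : val) : nat :=
  match a with
  | vtt => code2 0 0
  | vpair a b => code2 1 (code2 (val_code a) (val_code b))
  | vinl a => code2 2 (val_code a)
  | vinr a => code2 3 (val_code a)
  | vclo t e => code2 4 (code2 (tm_code t) (val_code e))
  | vrec t e => code2 5 (code2 (tm_code t) (val_code e))
  end.

Ltac code_inj :=
  let E := fresh in cbn [tm_code val_code]; intro E;
  repeat match goal with H : code2 _ _ = code2 _ _ |- _ =>
    apply (proj2_sig pairing) in H as [? ?] end;
  try discriminate; f_equal; auto.

Lemma tm_code_inj t t' : tm_code t = tm_code t' -> t = t'.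
Proof. revert t'; induction t; intros []; code_inj. Qed.

Lemma val_code_inj a b : val_code a = val_code b -> a = b.
Proof. revert b; induction a; intros []; code_inj; auto using tm_code_inj. Qed.

(** Zero and successor carry different tags, so [Case] can test a numeral and expose its
    predecessor. *)
Definition numeral (n : nat) : val := Nat.iter n vinr (vinl vtt).

Inductive eval : val -> tm -> val -> Prop :=
| ev_env s : eval s Env s
| ev_unit s : eval s Unit vtt
| ev_lam s t : eval s (Lam t) (vclo t s)
| ev_rec s t : eval s (Rec t) (vrec t s)
| ev_app_clo s t u b e a r :
    eval s t (vclo b e) -> eval s u a -> eval (vpair a e) b r -> eval s (App t u) r
| ev_app_rec s t u b e a r :
    eval s t (vrec b e) -> eval s u a -> eval (vpair a (vpair (vrec b e) e)) b r ->
    eval s (App t u) r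
| ev_pair s t u a b : eval s t a -> eval s u b -> eval s (MkPair t u) (vpair a b)
| ev_fst s t a b : eval s t (vpair a b) -> eval s (Fst t) a
| ev_snd s t a b : eval s t (vpair a b) -> eval s (Snd t) b
| ev_inl s t a : eval s t a -> eval s (Inl t) (vinl a)
| ev_inr s t a : eval s t a -> eval s (Inr t) (vinr a)
| ev_case_l s t u v a r :
    eval s t (vinl a) -> eval (vpair a s) u r -> eval s (Case t u v) r
| ev_case_r s t u v a r :
    eval s t (vinr a) -> eval (vpair a s) v r -> eval s (Case t u v) r
| ev_quote s t a : eval s t a -> eval s (Quote t) (numeral (val_code a)).

Lemma eval_fun s t a : eval s t a -> forall b, eval s t b -> a = b.
Proof.
  induction 1; intros r' H'; inversion H'; subst; clear H';
    repeat match goal with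
    | IH : forall b, eval ?s ?t b -> _ = b, H : eval ?s ?t _ |- _ =>
        apply IH in H; clear IH; try discriminate H; try (injection H; intros); subst
    end; auto.
Qed.

Definition apply_val (f a r : val) : Prop :=
  match f with
  | vclo b e => eval (vpair a e) b r
  | vrec b e => eval (vpair a (vpair f e)) b r
  | _ => False
  end.

Lemma apply_val_fun f a r r' : apply_val f a r -> apply_val f a r' -> r = r'.
Proof. destruct f; cbn; easy || eauto using eval_fun. Qed.

Lemma ev_app s t u f a r : eval s t f -> eval s u a -> apply_val f a r -> eval s (App t u) r.
Proof. destruct f; cbn; try easy; eauto using eval. Qed.

(** * Realizability predicates and their rules *)

Definition pred : Type := val -> Prop.

Definition pBot : pred := fun _ => False.
Definition pTop : pred := fun _ => True.
(** A uniform quantifier over [a] guarded by [pIs D a] is an ordinary one: its realizers receive or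
    return the value [a]. *)
Definition pIs (D : val -> Prop) (a : val) : pred := fun r => r = a /\ D a.
Definition pAnd (P Q : pred) : pred := fun r => exists a b, r = vpair a b /\ P a /\ Q b.
Definition pOr (P Q : pred) : pred := fun r =>
  (exists a, r = vinl a /\ P a) \/ (exists a, r = vinr a /\ Q a).
Definition pImp (P Q : pred) : pred := fun f =>
  forall a, P a -> exists r, apply_val f a r /\ Q r.
Definition pAll {I : Type} (P : I -> pred) : pred := fun r => forall i, P i r.
Definition pEx {I : Type} (P : I -> pred) : pred := fun r => exists i, P i r.

Definition realizes (s : val) (t : tm) (P : pred) : Prop := exists r, eval s t r /\ P r.
Definition valid (P : pred) : Prop := exists t, forall s, realizes s t P.

Lemma r_val s t (P : pred) a : eval s t a -> P a -> realizes s t P.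
Proof. now exists a. Qed.

Lemma r_is s t (D : val -> Prop) a : eval s t a -> D a -> realizes s t (pIs D a).
Proof. now exists a. Qed.

Lemma r_and s t u P Q : realizes s t P -> realizes s u Q -> realizes s (MkPair t u) (pAnd P Q).
Proof. intros (a & Ha & HP) (b & Hb & HQ). exists (vpair a b). split; [now constructor|now exists a, b]. Qed.

Lemma r_or_l s t P Q : realizes s t P -> realizes s (Inl t) (pOr P Q).
Proof. intros (a & Ha & HP). exists (vinl a). split; [now constructor|]. left; now exists a. Qed.

Lemma r_or_r s t P Q : realizes s t Q -> realizes s (Inr t) (pOr P Q).
Proof. intros (a & Ha & HP). exists (vinr a). split; [now constructor|]. right; now exists a. Qed.

Lemma r_imp s t P Q : (forall a, P a -> realizes (vpair a s) t Q) -> realizes s (Lam t) (pImp P Q).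
Proof. intro H. exists (vclo t s). split; [constructor|]. intros a Ha. exact (H a Ha). Qed.

Lemma r_vacuous s P Q : (forall a, ~ P a) -> realizes s (Lam Env) (pImp P Q).
Proof. intro H. apply r_imp. intros a Ha. destruct (H a Ha). Qed.

(** The realizer must not depend on [i]: this is where evaluation has to be deterministic. *)
Lemma r_all {I} (i0 : I) s t (P : I -> pred) : (forall i, realizes s t (P i)) -> realizes s t (pAll P).
Proof.
  intro H. destruct (H i0) as (r & Hr & _). exists r. split; [exact Hr|]. intro i.
  destruct (H i) as (r' & Hr' & HP). now rewrite (eval_fun _ _ _ Hr _ Hr').
Qed.

Lemma r_ex {I} (i : I) s t (P : I -> pred) : realizes s t (P i) -> realizes s t (pEx P).
Proof. intros (r & Hr & HP). exists r. split; [exact Hr|now exists i]. Qed.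

Lemma r_bot s t u P : realizes s t pBot -> realizes s u P.
Proof. now intros (r & _ & []). Qed.

Lemma r_app s t u P Q : realizes s t (pImp P Q) -> realizes s u P -> realizes s (App t u) Q.
Proof.
  intros (f & Hf & HPQ) (a & Ha & HP). destruct (HPQ a HP) as (r & Hr & HQ).
  exists r. split; [eapply ev_app; eauto|exact HQ].
Qed.

Lemma r_let s t u P Q :
  realizes s t P -> (forall a, P a -> realizes (vpair a s) u Q) -> realizes s (App (Lam u) t) Q.
Proof. intros HP HQ. eapply r_app; [apply r_imp, HQ|exact HP]. Qed.

Lemma r_case s t u v P Q S :
  realizes s t (pOr P Q) -> (forall a, P a -> realizes (vpair a s) u S) ->
  (forall a, Q a -> realizes (vpair a s) v S) -> realizes s (Case t u v) S.
Proof.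
  intros (r & Hr & [(a & -> & Ha)|(a & -> & Ha)]) HP HQ.
  - destruct (HP a Ha) as (b & Hb & HS). exists b. split; [eapply ev_case_l|]; eauto.
  - destruct (HQ a Ha) as (b & Hb & HS). exists b. split; [eapply ev_case_r|]; eauto.
Qed.

(** The program never sees [i], on which the recursion descends; its termination at each [i] is
    proved in the metatheory by well-founded induction. *)
Lemma r_rec {I} (i0 : I) (lt : I -> I -> Prop) (wf : well_founded lt) s t (P Q : I -> pred) :
  (forall i f a, P i a -> (forall j, lt j i -> pImp (P j) (Q j) f) ->
    realizes (vpair a (vpair f s)) t (Q i)) ->
  realizes s (Rec t) (pAll (fun i => pImp (P i) (Q i))).
Proof.
  intro H. exists (vrec t s). split; [constructor|]. intro i.
  induction i as [i IH] using (well_founded_ind wf). intros a Ha. cbn.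
  exact (H i (vrec t s) a Ha IH).
Qed.

Lemma valid_use P Q : valid P -> valid (pImp P Q) -> valid Q.
Proof. intros [t Ht] [u Hu]. exists (App u t). intro s. eapply r_app; auto. Qed.

Class inhab (I : Type) : Type := inhabitant : I.

(** An environment is a nested pair. The search for the component [v] builds the chain of
    projections that fetches it. *)
Ltac ev_find pf v :=
  lazymatch type of pf with eval _ _ ?s =>
    first
      [ constr_eq s v; exact pf
      | lazymatch s with vpair _ _ =>
          first [ev_find constr:(ev_fst _ _ _ _ pf) v | ev_find constr:(ev_snd _ _ _ _ pf) v]
        end ]
  end.
Ltac ev := lazymatch goal with |- eval ?s _ ?v =>
  first
    [ ev_find constr:(ev_env s) v
    | lazymatch v with
      | vpair _ _ => eapply ev_pair; ev
      | vinl _ => eapply ev_inl; ev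
      | vinr _ => eapply ev_inr; ev
      | numeral (val_code _) => eapply ev_quote; ev
      | vtt => apply ev_unit
      end ]
  end.
Tactic Notation "rall" ident(x) := eapply (r_all inhabitant); intro x.
Tactic Notation "rintro" simple_intropattern(p) := let a := fresh "arg" in
  eapply r_imp; intros a; intros p.
Tactic Notation "ruse" constr(H) := eapply r_val; [|exact H]; ev.
Tactic Notation "rapply" constr(H) := eapply r_app; [ruse H|].
Tactic Notation "rapply2" constr(H) := eapply r_app; [eapply r_app; [ruse H|]|].
Tactic Notation "rhave" constr(P) "as" simple_intropattern(p) := let a := fresh "arg" in
  eapply (r_let _ _ _ P); [|intros a; intros p].
Tactic Notation "rget" constr(H) "as" simple_intropattern(p) := let a := fresh "arg" in
  eapply r_let; [eapply r_app; [ruse H|]|intros a; intros p].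
Tactic Notation "rcase" constr(H) "as" simple_intropattern(p) := let a := fresh "arg" in
  eapply r_case; [ruse H|intros a; intros p|intros a; intros p].
Tactic Notation "valid_with" constr(L) := apply (valid_use _ _ L).
(** The realizer is left as a metavariable that the rules fill in; as it is created before the
    environment and the sets, it is uniform in them. *)
Ltac valid_start := let s := fresh "s" in eexists; intro s.

(** * The realizability model *)

(** [mkV D f] is the set of the [f a] with [D a]; [emptyV] is there because [mkV] alone
    would generate no set at all. *)
Inductive V : Type := emptyV | mkV (D : val -> Prop) (f : val -> V).

Definition ix (x : V) : val -> Prop := match x with emptyV => fun _ => False | mkV D _ => D end.
Definition elt (x : V) : val -> V := match x with emptyV => fun _ => emptyV | mkV _ f => f end.

#[global] Instance V_inhab : inhab V := emptyV.
#[global] Instance val_inhab : inhab val := vtt.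
#[global] Instance env_inhab : inhab (nat -> V) := fun _ => emptyV.

Definition child (y x : V) : Prop := exists a, ix x a /\ y = elt x a.

Lemma child_wf : well_founded child.
Proof.
  intro x. induction x as [|D f IH]; constructor; intros y (a & Ha & ->); [easy|apply IH].
Qed.

(** Bisimulation: each index of one set is sent to an index of an equal element of the other. [pTop]
    keeps the pair shape for [emptyV], so that [eqr_unfold] holds for every [x]. *)
Fixpoint eqr (x y : V) {struct x} : pred :=
  match x with
  | emptyV => pAnd pTop (pAll (fun b => pImp (pIs (ix y) b) pBot))
  | mkV D f => pAnd
     (pAll (fun a => pImp (pIs D a) (pEx (fun b => pAnd (pIs (ix y) b) (eqr (f a) (elt y b))))))
     (pAll (fun b => pImp (pIs (ix y) b) (pEx (fun a => pAnd (pIs D a) (eqr (f a) (elt y b))))))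
  end.

Lemma eqr_unfold x y v : eqr x y v <-> pAnd
  (pAll (fun a => pImp (pIs (ix x) a) (pEx (fun b => pAnd (pIs (ix y) b) (eqr (elt x a) (elt y b))))))
  (pAll (fun b => pImp (pIs (ix y) b) (pEx (fun a => pAnd (pIs (ix x) a) (eqr (elt x a) (elt y b)))))) v.
Proof.
  destruct x as [|D f]; [|reflexivity]. split; intros (a & b & -> & Ha & Hb);
    exists a, b; (split; [reflexivity|]); split; try easy.
  - intros i j [_ []].
  - intros i j Hj. now destruct (Hb i j Hj) as (? & ? & []).
  - intros i j Hj. now destruct (Hb i j Hj) as (? & ? & ? & ? & ? & ? & [? []] & ?).
Qed.

Lemma r_eqr s t u x y :
  realizes s t (pAll (fun a => pImp (pIs (ix x) a)
    (pEx (fun b => pAnd (pIs (ix y) b) (eqr (elt x a) (elt y b)))))) ->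
  realizes s u (pAll (fun b => pImp (pIs (ix y) b)
    (pEx (fun a => pAnd (pIs (ix x) a) (eqr (elt x a) (elt y b)))))) ->
  realizes s (MkPair t u) (eqr x y).
Proof.
  intros Ht Hu. destruct (r_and _ _ _ _ _ Ht Hu) as (r & Hr & H). exists r.
  split; [exact Hr|now apply eqr_unfold].
Qed.

Tactic Notation "req" hyp(H) "as" ident(H1) ident(H2) :=
  apply eqr_unfold in H; destruct H as (? & ? & -> & H1 & H2).

Lemma valid_rec (Q : V -> pred) :
  valid (pAll (fun x => pImp (pAll (fun a => pImp (pIs (ix x) a) (Q (elt x a)))) (Q x))) ->
  valid (pAll Q).
Proof.
  intro HQ. apply (valid_use _ _ HQ). clear HQ.
  (* [Rec] yields functions, so [Q x] is delayed by a dummy argument. *)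
  valid_start. rintro HQ. eapply (r_let _ _ _ (pAll (fun x => pImp pTop (Q x)))).
  - eapply (r_rec inhabitant child child_wf). intros x f b _ IH.
    rapply (HQ x). rall a. rintro [-> Ha].
    rapply (IH (elt x a) (ex_intro _ a (conj Ha eq_refl))).
    eapply (r_val _ Unit _ vtt); [constructor|exact I].
  - intros f Hf. rall x. rapply (Hf x). eapply (r_val _ Unit _ vtt); [constructor|exact I].
Qed.

Ltac ris := eapply r_is; [ev|assumption].

Lemma eqr_refl : valid (pAll (fun x => eqr x x)).
Proof.
  apply valid_rec. valid_start. rall x. rintro IH.
  apply r_eqr; rall b; rintro [-> Hb]; eapply (r_ex b), r_and; try ris; rapply (IH b); ris.
Qed.

Lemma eqr_sym : valid (pAll (fun x => pAll (fun y => pImp (eqr x y) (eqr y x)))).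
Proof.
  apply valid_rec. valid_start. rall x. rintro IH. rall y. rintro Hxy. req Hxy as H1 H2.
  apply r_eqr; rall b; rintro [-> Hb].
  - rget (H2 b) as H; [ris|]. destruct H as (c & ? & ? & -> & [-> Hc] & Hq).
    eapply (r_ex c), r_and; [ris|]. rget (IH c) as H; [ris|].
    rapply (H (elt y b)). ruse Hq.
  - rget (H1 b) as H; [ris|]. destruct H as (c & ? & ? & -> & [-> Hc] & Hq).
    eapply (r_ex c), r_and; [ris|]. rget (IH b) as H; [ris|].
    rapply (H (elt y c)). ruse Hq.
Qed.

Lemma eqr_trans :
  valid (pAll (fun x => pAll (fun y => pAll (fun z => pImp (eqr x y) (pImp (eqr y z) (eqr x z)))))).
Proof.
  apply valid_rec. valid_start. rall x. rintro IH. rall y. rall z.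
  rintro Hxy. rintro Hyz. req Hxy as H1 H2. req Hyz as H3 H4.
  apply r_eqr; rall b; rintro [-> Hb].
  - rget (H1 b) as H; [ris|]. destruct H as (c & ? & ? & -> & [-> Hc] & Hq).
    rget (H3 c) as H; [ris|]. destruct H as (d & ? & ? & -> & [-> Hd] & Hq').
    eapply (r_ex d), r_and; [ris|]. rget (IH b) as H; [ris|].
    rapply2 (H (elt y c) (elt z d)); [ruse Hq|ruse Hq'].
  - rget (H4 b) as H; [ris|]. destruct H as (c & ? & ? & -> & [-> Hc] & Hq).
    rget (H2 c) as H; [ris|]. destruct H as (d & ? & ? & -> & [-> Hd] & Hq').
    eapply (r_ex d), r_and; [ris|]. rget (IH d) as H; [ris|].
    rapply2 (H (elt y c) (elt z b)); [ruse Hq'|ruse Hq].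
Qed.

Definition memr (y x : V) : pred := pEx (fun a => pAnd (pIs (ix x) a) (eqr y (elt x a))).

Lemma memr_eqr_l :
  valid (pAll (fun x => pAll (fun y => pAll (fun z => pImp (eqr x y) (pImp (memr y z) (memr x z)))))).
Proof.
  valid_with eqr_trans. valid_start. rintro Htr. rall x. rall y. rall z.
  rintro Hxy. rintro (a & ? & ? & -> & [-> Ha] & Hq).
  eapply (r_ex a), r_and; [ris|]. rapply2 (Htr x y (elt z a)); [ruse Hxy|ruse Hq].
Qed.

Lemma memr_eqr_r :
  valid (pAll (fun x => pAll (fun y => pAll (fun z => pImp (eqr y z) (pImp (memr x y) (memr x z)))))).
Proof.
  valid_with eqr_trans. valid_start. rintro Htr. rall x. rall y. rall z.
  rintro Hyz. rintro (a & ? & ? & -> & [-> Ha] & Hq). req Hyz as H1 H2.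
  rget (H1 a) as H; [ris|]. destruct H as (b & ? & ? & -> & [-> Hb] & Hq').
  eapply (r_ex b), r_and; [ris|].
  rapply2 (Htr x (elt y a) (elt z b)); [ruse Hq|ruse Hq'].
Qed.

Definition rint : interp := Interp V pred pBot memr eqr pAnd pOr pImp pAll pEx.
Notation rsem := (sem rint).

(** [push z (insert k x r)] is convertible to [insert (S k) x (push z r)], so that a
    substitution passes under a quantifier. *)
Fixpoint insert (k : nat) (x : V) (r : nat -> V) : nat -> V :=
  match k with
  | 0 => push x r
  | S k => push (r 0) (insert k x (fun n => r (S n)))
  end.

Lemma insert_cases k n :
  (forall x r, insert k x r n = x) \/ exists m, forall x r, insert k x r n = r m.
Proof.
  revert n. induction k as [|k IH]; intros [|n]; cbn; eauto.
  destruct (IH n) as [H|[m H]]; [left|right; exists (S m)]; intros; apply H.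
Qed.

(** The position [k] is arbitrary because each quantifier raises it. Implication needs symmetry, as
    its premise is transported backwards. *)
Lemma subst_valid p : forall k,
  valid (pAll (fun r => pAll (fun x => pAll (fun y => pImp (eqr x y)
    (pImp (rsem p (insert k x r)) (rsem p (insert k y r))))))).
Proof.
  induction p; intro k; cbn.
  - valid_start. rall r. rall x. rall y. rintro _. now apply r_vacuous.
  - valid_with memr_eqr_l. valid_with memr_eqr_r. valid_with eqr_sym.
    destruct (insert_cases k x) as [Ex|[i Ex]], (insert_cases k y) as [Ey|[j Ey]];
      valid_start; rintro Hsym; rintro Hr; rintro Hl; rall r; rall u; rall v; rintro Huv;
      rintro H; rewrite ?Ex, ?Ey in H |- *.
    + rapply2 (Hl v u v); [rapply (Hsym u v); ruse Huv|].
      rapply2 (Hr u u v); [ruse Huv|ruse H].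
    + rapply2 (Hl v u (r j)); [rapply (Hsym u v); ruse Huv|ruse H].
    + rapply2 (Hr (r i) u v); [ruse Huv|ruse H].
    + ruse H.
  - valid_with eqr_trans. valid_with eqr_sym.
    destruct (insert_cases k x) as [Ex|[i Ex]], (insert_cases k y) as [Ey|[j Ey]];
      valid_start; rintro Hsym; rintro Ht; rall r; rall u; rall v; rintro Huv;
      rintro H; rewrite ?Ex, ?Ey in H |- *.
    + rapply2 (Ht v u v); [rapply (Hsym u v); ruse Huv|ruse Huv].
    + rapply2 (Ht v u (r j)); [rapply (Hsym u v); ruse Huv|ruse H].
    + rapply2 (Ht (r i) u v); [ruse H|ruse Huv].
    + ruse H.
  - valid_with (IHp1 k). valid_with (IHp2 k). valid_start. rintro H2. rintro H1.
    rall r. rall x. rall y. rintro Hxy. rintro (? & ? & -> & Hp & Hq). apply r_and.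
    + rapply2 (H1 r x y); [ruse Hxy|ruse Hp].
    + rapply2 (H2 r x y); [ruse Hxy|ruse Hq].
  - valid_with (IHp1 k). valid_with (IHp2 k). valid_start. rintro H2. rintro H1.
    rall r. rall x. rall y. rintro Hxy. rintro H. rcase H as Hp.
    + apply r_or_l. rapply2 (H1 r x y); [ruse Hxy|ruse Hp].
    + apply r_or_r. rapply2 (H2 r x y); [ruse Hxy|ruse Hp].
  - valid_with (IHp1 k). valid_with (IHp2 k). valid_with eqr_sym.
    valid_start. rintro Hsym. rintro H2. rintro H1.
    rall r. rall x. rall y. rintro Hxy. rintro H. rintro Hp.
    rapply2 (H2 r x y); [ruse Hxy|]. rapply H.
    rapply2 (H1 r y x); [rapply (Hsym x y); ruse Hxy|ruse Hp].
  - valid_with (IHp (S k)). valid_start. rintro H1. rall r. rall x. rall y. rintro Hxy.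
    rintro H. rall z. rapply2 (H1 (push z r) x y); [ruse Hxy|ruse (H z)].
  - valid_with (IHp (S k)). valid_start. rintro H1. rall r. rall x. rall y. rintro Hxy.
    rintro [z H]. apply (r_ex z). rapply2 (H1 (push z r) x y); [ruse Hxy|ruse H].
Qed.

(** * Soundness of the deduction rules *)

Fixpoint models (G : list form) (r : nat -> V) (s : val) : Prop :=
  match G with
  | [] => True
  | p :: G => exists a e, s = vpair a e /\ rsem p r a /\ models G r e
  end.

Lemma rsem_inst p x (r : nat -> V) : rsem (inst x p) r = rsem p (push (r x) r).
Proof. unfold inst. sem_eq. Qed.

Lemma rsem_shift p x (r : nat -> V) : rsem (shift p) (push x r) = rsem p r.
Proof. unfold shift. sem_eq. Qed.

Lemma models_shift G x r s : models G r s -> models (map shift G) (push x r) s.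
Proof.
  revert s. induction G as [|p G IH]; cbn; auto.
  intros s (a & e & -> & Ha & He). exists a, e. rewrite rsem_shift. auto.
Qed.

Lemma models_hyp G p : In p G -> forall u, exists t, forall r s e,
  eval s u e -> models G r e -> realizes s t (rsem p r).
Proof.
  induction G as [|q G IH]; intros [] u.
  - subst q. exists (Fst u). intros r s e He (a & e' & -> & Ha & _).
    eapply r_val; [eapply ev_fst, He|exact Ha].
  - destruct (IH H (Snd u)) as [t Ht]. exists t. intros r s e He (a & e' & -> & _ & HG).
    eapply Ht; [eapply ev_snd, He|exact HG].
Qed.

Lemma soundness G p : derives G p ->
  exists t, forall r e, models G r e -> realizes e t (rsem p r).
Proof.
  induction 1; repeat match goal with H : exists t, _ |- _ => destruct H as [? H] end.
  - destruct (models_hyp G p H Env) as [t Ht]. exists t. intros r e. apply Ht, ev_env.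
  - eexists. intros r e HG. apply (r_bot _ _ Env _ (IHderives r e HG)).
  - eexists. intros r e HG. apply r_and; auto.
  - eexists. intros r e HG. eapply r_let; [apply (IHderives r e HG)|].
    intros ? (a & b & -> & Ha & Hb). ruse Ha.
  - eexists. intros r e HG. eapply r_let; [apply (IHderives r e HG)|].
    intros ? (a & b & -> & Ha & Hb). ruse Hb.
  - eexists. intros r e HG. apply r_or_l; auto.
  - eexists. intros r e HG. apply r_or_r; auto.
  - eexists. intros r e HG. eapply r_case; [apply (IHderives1 r e HG)| |]; intros a Ha.
    + apply IHderives2. now exists a, e.
    + apply IHderives3. now exists a, e.
  - eexists. intros r e HG. apply r_imp. intros a Ha. apply IHderives. now exists a, e.
  - eexists. intros r e HG. eapply r_app; [apply (IHderives1 r e HG)|apply (IHderives2 r e HG)].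
  - eexists. intros r e HG. rall z. apply IHderives. now apply models_shift.
  - eexists. intros r e HG. rewrite rsem_inst. destruct (IHderives r e HG) as (a & Ha & H1).
    exact (r_val _ _ _ _ Ha (H1 (r x))).
  - eexists. intros r e HG. specialize (IHderives r e HG). rewrite rsem_inst in IHderives.
    exact (r_ex (r x) _ _ (fun z => rsem p (push z r)) IHderives).
  - eexists. intros r e HG. eapply r_let; [apply (IHderives1 r e HG)|]. intros a [z Ha].
    rewrite <- (rsem_shift _ z). apply IHderives2. exists a, e.
    split; [reflexivity|]. split; [exact Ha|now apply models_shift].
  - destruct eqr_refl as [t Ht]. exists t. intros r e _. destruct (Ht e) as (a & Ha & H).
    exact (r_val _ _ _ _ Ha (H (r x))).
  - destruct (subst_valid p 0) as [t Ht]. eexists. intros r e HG. rewrite rsem_inst.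
    specialize (IHderives1 r e HG). specialize (IHderives2 r e HG). rewrite rsem_inst in IHderives2.
    destruct (Ht e) as (a & Ha & H1). specialize (H1 r (r x) (r y)).
    eapply r_app; [eapply r_app|].
    + exact (r_val _ _ _ _ Ha H1).
    + exact IHderives1.
    + exact IHderives2.
Qed.

Lemma consistent_of_realized (T : theory) :
  (forall p, T p -> exists t, forall s r, realizes s t (rsem p r)) -> consistent T.
Proof.
  intros HT (G & HG & Hd).
  assert (exists s, models G (fun _ => emptyV) s) as [s Hs].
  { clear Hd. induction G as [|q G IH]; [now exists vtt|].
    destruct IH as [e He]; [intros; apply HG; now right|].
    destruct (HT q (HG q (or_introl eq_refl))) as [t Ht].
    destruct (Ht vtt (fun _ => emptyV)) as (a & _ & Ha). exists (vpair a e). now exists a, e. }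
  destruct (soundness G Bot Hd) as [t Ht]. now destruct (Ht _ _ Hs) as (a & _ & []).
Qed.

(** Universal closure costs nothing: a uniform realizer of all instances already realizes it. *)
Lemma realized_axiom p : valid (pAll (rsem (open_form p))) ->
  exists t, forall s r, realizes s t (rsem (axiom p) r).
Proof.
  intros [t Ht]. exists t. intros s. unfold axiom, all_closure.
  assert (H : forall r, realizes s t (rsem (open_form p) r)).
  { intro r. destruct (Ht s) as (a & Ha & H). exact (r_val _ _ _ _ Ha (H r)). }
  generalize dependent (open_form p). intros q _ H. induction (fv_bound q) as [|n IH]; auto.
  intro r. apply (r_all (I := V) inhabitant). intro x. apply IH.
Qed.

(** The realizer is one and the same pair for every [i]; an inhabitant of [I] is needed to see that
    it is a pair. *)
Lemma pAll_pAnd {I} `{inhab I} (P Q : I -> pred) v :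
  pAll (fun i => pAnd (P i) (Q i)) v -> pAnd (pAll P) (pAll Q) v.
Proof.
  intro H0. destruct (H0 inhabitant) as (a & b & -> & _). exists a, b.
  split; [reflexivity|]. split; intro i; destruct (H0 i) as (? & ? & [= <- <-] & ?); tauto.
Qed.

(** * Set existence axioms in the model *)

Ltac rmem i := eapply (r_ex i), r_and; [eapply r_is; [ev|]|].

Definition pIff (P Q : pred) : pred := pAnd (pImp P Q) (pImp Q P).

Lemma ext_valid : valid (pAll (fun a => pAll (fun b =>
  pImp (pAll (fun x => pIff (memr x a) (memr x b))) (eqr a b)))).
Proof.
  valid_with eqr_refl. valid_with eqr_sym. valid_start. rintro Hsym. rintro Hrefl.
  rall a. rall b. rintro H. apply pAll_pAnd in H. destruct H as (? & ? & -> & H1 & H2).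
  apply r_eqr; rall i; rintro [-> Hi].
  - rget (H1 (elt a i)) as (j & ? & ? & -> & [-> Hj] & Hq).
    { rmem i; [exact Hi|]. ruse (Hrefl (elt a i)). }
    rmem j; [exact Hj|]. ruse Hq.
  - rget (H2 (elt b i)) as (j & ? & ? & -> & [-> Hj] & Hq).
    { rmem i; [exact Hi|]. ruse (Hrefl (elt b i)). }
    rmem j; [exact Hj|]. rapply (Hsym (elt b i) (elt a j)). ruse Hq.
Qed.

Definition upairV (a b : V) : V :=
  mkV (fun i => i = vinl vtt \/ i = vinr vtt) (fun i => match i with vinl _ => a | _ => b end).

Definition pUpair (p a b : V) : pred := pAll (fun z => pIff (memr z p) (pOr (eqr z a) (eqr z b))).

Lemma upair_valid : valid (pAll (fun a => pAll (fun b => pUpair (upairV a b) a b))).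
Proof.
  valid_start. rall a. rall b. rall x. apply r_and.
  - rintro (i & ? & ? & -> & [-> Hi] & Hq).
    (* The index [i] carries a tag and is itself used as the realizer of a disjunction. *)
    eapply (r_case _ _ _ _ (fun _ => i = vinl vtt) (fun _ => i = vinr vtt)).
    + eapply (r_val _ _ _ i); [ev|]. destruct Hi as [->| ->]; [left|right]; eauto.
    + intros ? ->. apply r_or_l. ruse Hq.
    + intros ? ->. apply r_or_r. ruse Hq.
  - rintro H. rcase H as Hq.
    + rmem (vinl vtt); [now left|]. ruse Hq.
    + rmem (vinr vtt); [now right|]. ruse Hq.
Qed.

Definition unionV (a : V) : V :=
  mkV (fun k => exists i j, k = vpair i j /\ ix a i /\ ix (elt a i) j)
    (fun k => match k with vpair i j => elt (elt a i) j | _ => emptyV end).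

Lemma union_valid : valid (pAll (fun a => pAll (fun x =>
  pIff (memr x (unionV a)) (pEx (fun y => pAnd (memr y a) (memr x y)))))).
Proof.
  valid_with eqr_refl. valid_with memr_eqr_r. valid_start. rintro Hr. rintro Hrefl.
  rall a. rall x. apply r_and.
  - rintro (k & ? & ? & -> & [-> (i & j & -> & Hi & Hj)] & Hq).
    apply (r_ex (elt a i)), r_and.
    + rmem i; [exact Hi|]. ruse (Hrefl (elt a i)).
    + rmem j; [exact Hj|]. ruse Hq.
  - rintro (y & ? & ? & -> & (i & ? & ? & -> & [-> Hi] & Hq) & Hx).
    eapply r_let; [rapply2 (Hr x y (elt a i)); [ruse Hq|ruse Hx]|].
    intros ? (j & ? & ? & -> & [-> Hj] & Hq').
    rmem (vpair i j); [now exists i, j|]. ruse Hq'.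
Qed.

(** An index stores a realizer of the separating property, which membership can then return. *)
Definition sepV (a : V) (P : V -> pred) : V :=
  mkV (fun k => exists i e, k = vpair i e /\ ix a i /\ P (elt a i) e)
    (fun k => match k with vpair i _ => elt a i | _ => emptyV end).

Lemma sep_valid p : valid (pAll (fun r => pAll (fun a => pAll (fun y =>
  pIff (memr y (sepV a (fun z => rsem p (push z r)))) (pAnd (memr y a) (rsem p (push y r))))))).
Proof.
  valid_with eqr_sym. valid_with (subst_valid p 0). valid_start. rintro Hs. rintro Hsym.
  rall r. rall a. rall y. apply r_and.
  - rintro (k & ? & ? & -> & [-> (i & e & -> & Hi & He)] & Hq). apply r_and.
    + rmem i; [exact Hi|]. ruse Hq.
    + rapply2 (Hs r (elt a i) y); [rapply (Hsym y (elt a i)); ruse Hq|ruse He].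
  - rintro (? & ? & -> & (i & ? & ? & -> & [-> Hi] & Hq) & Hp).
    eapply r_let; [rapply2 (Hs r y (elt a i)); [ruse Hq|ruse Hp]|]. intros e He.
    rmem (vpair i e); [now exists i, e|]. ruse Hq.
Qed.

Lemma set_induction_valid p : valid (pAll (fun r => pImp
  (pAll (fun a => pImp (pAll (fun x => pImp (memr x a) (rsem p (push x r)))) (rsem p (push a r))))
  (pAll (fun a => rsem p (push a r))))).
Proof.
  (* The set is quantified before [r] to fit [valid_rec]; uniform quantifiers commute. *)
  assert (H : valid (pAll (fun a => pAll (fun r => pImp
    (pAll (fun a => pImp (pAll (fun x => pImp (memr x a) (rsem p (push x r)))) (rsem p (push a r))))
    (rsem p (push a r)))))).
  { apply valid_rec. valid_with eqr_sym. valid_with (subst_valid p 0). valid_start.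
    rintro Hs. rintro Hsym. rall a. rintro IH. rall r. rintro H. rapply (H a).
    rall y. rintro (i & ? & ? & -> & [-> Hi] & Hq).
    rapply2 (Hs r (elt a i) y); [rapply (Hsym y (elt a i)); ruse Hq|].
    rget (IH i) as H'; [ris|]. rapply (H' r). ruse H. }
  valid_with H. valid_start. rintro Hr. rall r. rintro Hp. rall a. rapply (Hr a r). ruse Hp.
Qed.

(** The witness is absent from the realizer, so it is chosen in the metatheory, one for each index,
    while [f] stays the same. *)
Lemma choice_bounded {I} `{inhab I} (D : val -> Prop) (P : val -> I -> pred) f :
  pAll (fun i => pImp (pIs D i) (pEx (P i))) f ->
  exists Y : val -> I, pAll (fun i => pImp (pIs D i) (P i (Y i))) f.
Proof.
  intro Hf.
  destruct (functional_choice (fun i y => D i -> exists c, apply_val f i c /\ P i y c)) as [Y HY].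
  - intro i. destruct (classic (D i)) as [Hi|Hi].
    + destruct (Hf i i (conj eq_refl Hi)) as (c & Hc & y & Hy). exists y. eauto.
    (* Functional choice asks for a total relation; outside [D] any value does. *)
    + now exists inhabitant.
  - exists Y. intros i j [-> Hi]. exact (HY i Hi).
Qed.

Definition pFull (a b : V) (R : V -> V -> pred) : pred :=
  pAnd (pAll (fun x => pImp (memr x a) (pEx (fun y => pAnd (memr y b) (R x y)))))
       (pAll (fun y => pImp (memr y b) (pEx (fun x => pAnd (memr x a) (R x y))))).

Lemma strong_collection_valid p : valid (pAll (fun r => pAll (fun a => pImp
  (pAll (fun x => pImp (memr x a) (pEx (fun y => rsem p (push x (push y r))))))
  (pEx (fun b => pFull a b (fun x y => rsem p (push x (push y r)))))))).
Proof.
  valid_with eqr_refl. valid_with eqr_sym. valid_with (subst_valid p 0). valid_with (subst_valid p 1).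
  valid_start. rintro Hs1. rintro Hs0. rintro Hsym. rintro Hrefl. rall r. rall a. rintro H.
  eapply (r_let _ _ _ (pAll (fun i => pImp (pIs (ix a) i)
    (pEx (fun y => rsem p (push (elt a i) (push y r))))))).
  { rall i. rintro [-> Hi]. rapply (H (elt a i)). rmem i; [exact Hi|]. ruse (Hrefl (elt a i)). }
  intros f Hf. apply choice_bounded in Hf as [Y HY]. apply (r_ex (mkV (ix a) Y)), r_and.
  - rall x. rintro (i & ? & ? & -> & [-> Hi] & Hq). apply (r_ex (Y i)), r_and.
    + rmem i; [exact Hi|]. ruse (Hrefl (Y i)).
    + rapply2 (Hs0 (push (Y i) r) (elt a i) x); [rapply (Hsym x (elt a i)); ruse Hq|].
      rapply (HY i). ris.
  - rall y. rintro (i & ? & ? & -> & [-> Hi] & Hq). apply (r_ex (elt a i)), r_and.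
    + rmem i; [exact Hi|]. ruse (Hrefl (elt a i)).
    + rapply2 (Hs1 (push (elt a i) r) (Y i) y); [rapply (Hsym y (Y i)); ruse Hq|].
      rapply (HY i). ris.
Qed.

(** An index of [graphV a b f] contains a whole value of [f], so that the realizer computed
    by [f] can be recovered from an element of the set. *)
Definition graphV (a b : V) (f : val) : V :=
  mkV (fun k => exists i j e, k = vpair i (vpair j e) /\ ix a i /\ ix b j /\ apply_val f i (vpair j e))
    (fun k => match k with vpair _ (vpair j _) => elt b j | _ => emptyV end).
(** One set of candidates for all [u]: a realizer of the totality premise is a value, so the values
    that send indices of [a] to pairs starting with an index of [b] can serve as indices. *)
Definition imagesV (a b : V) : V :=
  mkV (fun f => forall i, ix a i -> exists j e, ix b j /\ apply_val f i (vpair j e)) (graphV a b).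

Lemma subset_collection_valid p : valid (pAll (fun r => pAll (fun a => pAll (fun b => pEx (fun c =>
  pAll (fun u => pImp
    (pAll (fun x => pImp (memr x a)
      (pEx (fun y => pAnd (memr y b) (rsem p (push x (push y (push u r))))))))
    (pEx (fun d => pAnd (memr d c)
      (pFull a d (fun x y => rsem p (push x (push y (push u r))))))))))))).
Proof.
  valid_with eqr_refl. valid_with eqr_sym. valid_with (subst_valid p 0). valid_with (subst_valid p 1).
  valid_start. rintro Hs1. rintro Hs0. rintro Hsym. rintro Hrefl. rall r. rall a. rall b.
  apply (r_ex (imagesV a b)). rall u. rintro H.
  eapply (r_let _ _ _ (pAll (fun i => pImp (pIs (ix a) i)
    (pEx (fun j => pAnd (pIs (ix b) j) (rsem p (push (elt a i) (push (elt b j) (push u r))))))))).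
  { rall i. rintro [-> Hi]. rget (H (elt a i)) as H'.
    { rmem i; [exact Hi|]. ruse (Hrefl (elt a i)). }
    destruct H' as (y & ? & ? & -> & (j & ? & ? & -> & [-> Hj] & Hq) & Hp).
    apply (r_ex j), r_and; [ris|].
    rapply2 (Hs1 (push (elt a i) (push u r)) y (elt b j)); [ruse Hq|ruse Hp]. }
  intros f Hf.
  assert (Hf' : forall i, ix a i -> exists j e, ix b j /\ apply_val f i (vpair j e) /\
    rsem p (push (elt a i) (push (elt b j) (push u r))) e).
  { intros i Hi. destruct (Hf i i (conj eq_refl Hi)) as (c & Hc & j & ? & e & -> & [-> Hj] & He).
    exists j, e. auto. }
  apply (r_ex (graphV a b f)), r_and.
  { rmem f; [|ruse (Hrefl (graphV a b f))]. intros i Hi. destruct (Hf' i Hi) as (j & e & ? & ? & _). eauto. }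
  apply r_and.
  - rall x. rintro (i & ? & ? & -> & [-> Hi] & Hq).
    (* The computed value is named together with [apply_val f i z], which an index of [graphV a b f]
       requires. *)
    eapply (r_let _ _ _ (fun z => exists j e, z = vpair j e /\ ix b j /\ apply_val f i z /\
      rsem p (push (elt a i) (push (elt b j) (push u r))) e)).
    { eapply (r_app _ _ _ (pIs (ix a) i)); [|ris]. eapply (r_val _ _ _ f); [ev|]. intros ? [-> _].
      destruct (Hf' i Hi) as (j & e & Hj & Hfi & He). eauto 10. }
    intros ? (j & e & -> & Hj & Hfi & He). apply (r_ex (elt b j)), r_and.
    + rmem (vpair i (vpair j e)); [exists i, j, e; auto|]. ruse (Hrefl (elt b j)).
    + rapply2 (Hs0 (push (elt b j) (push u r)) (elt a i) x); [rapply (Hsym x (elt a i)); ruse Hq|].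
      ruse He.
  - rall y. rintro (k & ? & ? & -> & [-> (i & j & e & -> & Hi & Hj & Hfi)] & Hq).
    apply (r_ex (elt a i)), r_and.
    + rmem i; [exact Hi|]. ruse (Hrefl (elt a i)).
    + rapply2 (Hs1 (push (elt a i) (push u r)) (elt b j) y); [rapply (Hsym y (elt b j)); ruse Hq|].
      (* Evaluation is deterministic, so the stored [e] is the realizer that [f] returns at [i]. *)
      destruct (Hf' i Hi) as (j' & e' & _ & Hfi' & He).
      injection (apply_val_fun _ _ _ _ Hfi Hfi') as <- <-. ruse He.
Qed.

(** * Natural numbers and the uniformity principle in the model *)

Definition succV (x : V) : V :=
  mkV (fun k => (exists i, k = vinl i /\ ix x i) \/ k = vinr vtt)
    (fun k => match k with vinl i => elt x i | _ => x end).
Fixpoint numV (a : val) : V := match a with vinr a => succV (numV a) | _ => emptyV end.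
Definition omegaV : V := mkV (fun a => exists n, a = numeral n) numV.

Definition pEmpty (x : V) : pred := pAll (fun y => pImp (memr y x) pBot).
Definition pSucc (x y : V) : pred := pAll (fun z => pIff (memr z y) (pOr (memr z x) (eqr z x))).
Definition pOmega (w : V) : pred := pAll (fun x => pIff (memr x w)
  (pOr (pEmpty x) (pEx (fun y => pAnd (memr y w) (pSucc y x))))).
Definition pN (x : V) : pred := pEx (fun w => pAnd (pOmega w) (memr x w)).

Lemma succ_valid : valid (pAll (fun x => pSucc x (succV x))).
Proof.
  valid_start. rall x. rall z. apply r_and.
  - rintro (k & ? & ? & -> & [-> Hk] & Hq).
    eapply (r_case _ _ _ _ (fun i => k = vinl i /\ ix x i) (fun _ => k = vinr vtt)).
    + eapply (r_val _ _ _ k); [ev|]. destruct Hk as [(i & -> & Hi)| ->]; [left|right]; eauto.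
    + intros i [-> Hi]. apply r_or_l. rmem i; [exact Hi|]. ruse Hq.
    + intros ? ->. apply r_or_r. ruse Hq.
  - rintro H. rcase H as Hz.
    + destruct Hz as (i & ? & ? & -> & [-> Hi] & Hq). rmem (vinl i); [left; eauto|]. ruse Hq.
    + rmem (vinr vtt); [now right|]. ruse Hz.
Qed.

Lemma succ_eqr_l : valid (pAll (fun x => pAll (fun y => pAll (fun z =>
  pImp (eqr x y) (pImp (pSucc x z) (pSucc y z)))))).
Proof.
  valid_with (subst_valid (open_form (is_succ (fv 0) (fv 1))) 0). valid_start. rintro Hs.
  rall x. rall y. rall z. ruse (Hs (push z (fun _ => emptyV)) x y).
Qed.

Lemma succ_eqr_r : valid (pAll (fun x => pAll (fun y => pAll (fun z =>
  pImp (eqr x y) (pImp (pSucc z x) (pSucc z y)))))).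
Proof.
  valid_with (subst_valid (open_form (is_succ (fv 0) (fv 1))) 1). valid_start. rintro Hs.
  rall x. rall y. rall z. ruse (Hs (push z (fun _ => emptyV)) x y).
Qed.

Lemma succ_unique : valid (pAll (fun x => pAll (fun y => pAll (fun z =>
  pImp (pSucc x y) (pImp (pSucc x z) (eqr y z)))))).
Proof.
  valid_with ext_valid. valid_start. rintro Hext. rall x. rall y. rall z. rintro Hy. rintro Hz.
  apply pAll_pAnd in Hy, Hz. destruct Hy as (? & ? & -> & H1 & H2), Hz as (? & ? & -> & H3 & H4).
  rapply (Hext y z). rall u. apply r_and; rintro Hu.
  - rapply (H4 u). rapply (H1 u). ruse Hu.
  - rapply (H2 u). rapply (H3 u). ruse Hu.
Qed.

Lemma omega_valid : valid (pOmega omegaV).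
Proof.
  valid_with eqr_refl. valid_with eqr_sym. valid_with eqr_trans. valid_with memr_eqr_r.
  valid_with succ_valid. valid_with succ_eqr_l. valid_with succ_eqr_r. valid_with succ_unique.
  valid_start. rintro Hun. rintro Hsr. rintro Hsl. rintro Hsuc. rintro Hr. rintro Htr. rintro Hsym.
  rintro Hrefl. rall x. apply r_and.
  - rintro (a & ? & ? & -> & [-> [n Hn]] & Hq).
    eapply (r_case _ _ _ _ (fun _ => a = vinl vtt) (fun b => a = vinr b /\ ix omegaV b)).
    + eapply (r_val _ _ _ a); [ev|]. destruct n as [|n]; [left; eauto|right].
      exists (numeral n). split; [exact Hn|]. split; [exact Hn|now exists n].
    + intros ? ->. apply r_or_l. rall y. rintro Hy.
      eapply r_let; [rapply2 (Hr y x emptyV); [ruse Hq|ruse Hy]|].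
      intros ? Hm. eapply (r_val _ Env); [apply ev_env|].
      now destruct Hm as (? & ? & ? & _ & [_ []] & _).
    + intros b [-> Hb]. apply r_or_r. apply (r_ex (numV b)), r_and.
      * rmem b; [exact Hb|]. ruse (Hrefl (numV b)).
      * rapply2 (Hsr (succV (numV b)) x (numV b)); [|ruse (Hsuc (numV b))].
        rapply (Hsym x (succV (numV b))). ruse Hq.
  - rintro H. rcase H as Hx.
    + rmem (vinl vtt); [now exists 0|]. apply r_eqr; rall i.
      * rintro [-> Hi]. eapply (r_bot _ _ Env). rapply (Hx (elt x i)). rmem i; [exact Hi|]. ruse (Hrefl (elt x i)).
      * apply r_vacuous. now intros ? [_ []].
    + destruct Hx as (y & ? & ? & -> & (b & ? & ? & -> & [-> [n ->]] & Hq) & Hs).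
      rmem (vinr (numeral n)); [now exists (S n)|].
      rapply2 (Hun (numV (numeral n)) x (succV (numV (numeral n)))).
      * rapply2 (Hsl y (numV (numeral n)) x); [ruse Hq|ruse Hs].
      * ruse (Hsuc (numV (numeral n))).
Qed.

(** The [w] in [pN] is arbitrary and its indices say nothing about numbers. Descending through
    predecessors, induction on [y] moves membership into [omegaV], whose indices are numerals. *)
Lemma N_omega_valid : valid (pAll (fun y => pImp (pN y) (memr y omegaV))).
Proof.
  assert (H : valid (pAll (fun y => pAll (fun w => pImp (pOmega w)
    (pImp (memr y w) (memr y omegaV)))))).
  { apply valid_rec. valid_with eqr_refl. valid_with eqr_sym. valid_with memr_eqr_l.
    valid_with omega_valid. valid_start.
    rintro Ho. rintro Hl. rintro Hsym. rintro Hrefl. rall y. rintro IH. rall w. rintro Hw. rintro Hy.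
    apply pAll_pAnd in Ho. destruct Ho as (? & ? & -> & _ & Ho).
    assert (Hw' := Hw). apply pAll_pAnd in Hw'. destruct Hw' as (? & ? & -> & Hw' & _).
    eapply r_case; [rapply (Hw' y); ruse Hy| |].
    - intros e He. rapply (Ho y). apply r_or_l. ruse He.
    - intros ? (z & ? & ? & -> & Hz & Hs). rapply (Ho y). apply r_or_r. apply (r_ex z), r_and; [|ruse Hs].
      assert (Hs' := Hs). apply pAll_pAnd in Hs'. destruct Hs' as (? & ? & -> & _ & Hs').
      rget (Hs' z) as H; [apply r_or_r; ruse (Hrefl z)|].
      destruct H as (i & ? & ? & -> & [-> Hi] & Hq).
      rget (IH i) as H; [ris|]. rapply2 (Hl z (elt y i) omegaV); [ruse Hq|].
      rapply2 (H w); [ruse Hw|]. rapply2 (Hl (elt y i) z w); [|ruse Hz].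
      rapply (Hsym z (elt y i)). ruse Hq. }
  valid_with H. valid_start. rintro H0. rall y. rintro (w & ? & ? & -> & Hw & Hy).
  rapply2 (H0 y w); [ruse Hw|ruse Hy].
Qed.

Lemma r_frame s t (P : pred) (M : Prop) : realizes s t P -> M -> realizes s t (fun c => P c /\ M).
Proof. intros (c & Hc & HP) HM. exists c. auto. Qed.

(** The premise has one realizer [e0], [e1] for all [x]. From [e0] one index [n] is computed,
    independent of [x], so each [y] equals [numV n] and [e1] can be transported. [r_frame] ties [e1]
    to the same [y] during this computation. *)
Lemma uniformity_valid p : valid (pAll (fun r => pImp
  (pAll (fun x => pEx (fun y => pAnd (pN y) (rsem p (push x (push y r))))))
  (pEx (fun y => pAnd (pN y) (pAll (fun x => rsem p (push x (push y r)))))))).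
Proof.
  valid_with eqr_refl. valid_with omega_valid. valid_with N_omega_valid. valid_with (subst_valid p 1).
  valid_start. rintro Hs. rintro HN. rintro Ho. rintro Hrefl. rall r. apply r_imp. intros v H.
  destruct (H emptyV) as (_ & e0 & e1 & -> & _).
  eapply (r_let _ _ _ (pAll (fun x => pEx (fun y c => memr y omegaV c /\ rsem p (push x (push y r)) e1)))).
  { rall x. destruct (H x) as (y & ? & ? & [= <- <-] & Hy & Hp). apply (r_ex y), r_frame; [|exact Hp].
    rapply (HN y). ruse Hy. }
  intros c Hc. destruct (Hc emptyV) as (_ & (n & ? & q & -> & [-> Hn] & _) & _).
  apply (r_ex (numV n)), r_and.
  - apply (r_ex omegaV), r_and; [ruse Ho|]. rmem n; [exact Hn|]. ruse (Hrefl (numV n)).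
  - rall x. destruct (Hc x) as (y & (? & ? & ? & [= <- <-] & [<- _] & Hq) & Hp).
    rapply2 (Hs (push x r) y (numV n)); [ruse Hq|ruse Hp].
Qed.

(** * Ordered pairs in the model *)

Definition pOpair (p a b : V) : pred := pEx (fun s => pEx (fun t =>
  pAnd (pUpair s a a) (pAnd (pUpair t a b) (pUpair p s t)))).

Definition opairV (a b : V) : V := upairV (upairV a a) (upairV a b).

Lemma opair_valid : valid (pAll (fun a => pAll (fun b => pOpair (opairV a b) a b))).
Proof.
  valid_with upair_valid. valid_start. rintro Hu. rall a. rall b.
  apply (r_ex (upairV a a)), (r_ex (upairV a b)), r_and; [ruse (Hu a a)|].
  apply r_and; [ruse (Hu a b)|]. ruse (Hu (upairV a a) (upairV a b)).
Qed.

Lemma opair_eqr : valid (pAll (fun p => pAll (fun p' => pAll (fun a => pAll (fun b =>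
  pImp (eqr p p') (pImp (pOpair p a b) (pOpair p' a b))))))).
Proof.
  valid_with (subst_valid (open_form (is_opair (fv 0) (fv 1) (fv 2))) 0). valid_start. rintro Hs.
  rall p. rall p'. rall a. rall b. ruse (Hs (push a (push b (fun _ => emptyV))) p p').
Qed.

Lemma opair_eqr_fst : valid (pAll (fun p => pAll (fun a => pAll (fun a' => pAll (fun b =>
  pImp (eqr a a') (pImp (pOpair p a b) (pOpair p a' b))))))).
Proof.
  valid_with (subst_valid (open_form (is_opair (fv 0) (fv 1) (fv 2))) 1). valid_start. rintro Hs.
  rall p. rall a. rall a'. rall b. ruse (Hs (push p (push b (fun _ => emptyV))) a a').
Qed.

Lemma opair_eqr_snd : valid (pAll (fun p => pAll (fun a => pAll (fun b => pAll (fun b' =>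
  pImp (eqr b b') (pImp (pOpair p a b) (pOpair p a b'))))))).
Proof.
  valid_with (subst_valid (open_form (is_opair (fv 0) (fv 1) (fv 2))) 2). valid_start. rintro Hs.
  rall p. rall a. rall b. rall b'. ruse (Hs (push p (push a (fun _ => emptyV))) b b').
Qed.

Lemma upair_l : valid (pAll (fun p => pAll (fun a => pAll (fun b => pImp (pUpair p a b) (memr a p))))).
Proof.
  valid_with eqr_refl. valid_start. rintro Hrefl. rall p. rall a. rall b. rintro H.
  apply pAll_pAnd in H. destruct H as (? & ? & -> & _ & H). rapply (H a). apply r_or_l. ruse (Hrefl a).
Qed.

Lemma upair_r : valid (pAll (fun p => pAll (fun a => pAll (fun b => pImp (pUpair p a b) (memr b p))))).
Proof.
  valid_with eqr_refl. valid_start. rintro Hrefl. rall p. rall a. rall b. rintro H.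
  apply pAll_pAnd in H. destruct H as (? & ? & -> & _ & H). rapply (H b). apply r_or_r. ruse (Hrefl b).
Qed.

Lemma upair_e : valid (pAll (fun p => pAll (fun a => pAll (fun b => pAll (fun z =>
  pImp (pUpair p a b) (pImp (memr z p) (pOr (eqr z a) (eqr z b)))))))).
Proof.
  valid_start. rall p. rall a. rall b. rall z. rintro H. rintro Hz.
  apply pAll_pAnd in H. destruct H as (? & ? & -> & H & _). rapply (H z). ruse Hz.
Qed.

Lemma upair_single : valid (pAll (fun p => pAll (fun a => pAll (fun z =>
  pImp (pUpair p a a) (pImp (memr z p) (eqr z a)))))).
Proof.
  valid_with upair_e. valid_start. rintro He. rall p. rall a. rall z. rintro H. rintro Hz.
  eapply r_case; [rapply2 (He p a a z); [ruse H|ruse Hz]| |]; intros q Hq; ruse Hq.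
Qed.

(** [{a}] equals [{a'}] or [{a',b'}], and both contain [a']. *)
Lemma opair_fst_valid : valid (pAll (fun p => pAll (fun a => pAll (fun b => pAll (fun a' => pAll (fun b' =>
  pImp (pOpair p a b) (pImp (pOpair p a' b') (eqr a a')))))))).
Proof.
  valid_with eqr_sym. valid_with memr_eqr_r. valid_with upair_l. valid_with upair_e.
  valid_with upair_single. valid_start. rintro Hsg. rintro He. rintro Hul. rintro Hr. rintro Hsym.
  rall p. rall a. rall b. rall a'. rall b'.
  rintro (s0 & t & ? & ? & -> & Hs & ? & ? & -> & Ht & Hp).
  rintro (s' & t' & ? & ? & -> & Hs' & ? & ? & -> & Ht' & Hp').
  rapply (Hsym a' a). rapply2 (Hsg s0 a a'); [ruse Hs|].
  eapply r_case; [rapply2 (He p s' t' s0); [ruse Hp'|rapply (Hul p s0 t); ruse Hp]| |]; intros q Hq.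
  - rapply2 (Hr a' s' s0); [rapply (Hsym s0 s'); ruse Hq|]. rapply (Hul s' a' a'). ruse Hs'.
  - rapply2 (Hr a' t' s0); [rapply (Hsym s0 t'); ruse Hq|]. rapply (Hul t' a' b'). ruse Ht'.
Qed.

(** Whether [a = b] cannot be decided by a program, so the cases come from [{a,b}] and [{a',b'}]
    being members of [p]. [Hfin] settles the crossed case [b = a'], [b' = a] by means of
    [a = a']. *)
Lemma opair_snd_valid : valid (pAll (fun p => pAll (fun a => pAll (fun b => pAll (fun a' => pAll (fun b' =>
  pImp (pOpair p a b) (pImp (pOpair p a' b') (eqr b b')))))))).
Proof.
  valid_with eqr_sym. valid_with eqr_trans. valid_with memr_eqr_r. valid_with upair_r. valid_with upair_e.
  valid_with upair_single. valid_with opair_fst_valid.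
  valid_start. rintro Hfst. rintro Hsg. rintro He. rintro Hur. rintro Hr. rintro Htr. rintro Hsym.
  rall p. rall a. rall b. rall a'. rall b'. rintro HO. rintro HO'.
  rhave (eqr a a') as Haa; [rapply2 (Hfst p a b a' b'); [ruse HO|ruse HO']|].
  destruct HO as (s0 & t & ? & ? & -> & Hs & ? & ? & -> & Ht & Hp).
  destruct HO' as (s' & t' & ? & ? & -> & Hs' & ? & ? & -> & Ht' & Hp').
  rhave (memr b t) as Hbt; [rapply (Hur t a b); ruse Ht|].
  rhave (memr b' t') as Hbt'; [rapply (Hur t' a' b'); ruse Ht'|].
  eapply (r_let _ _ _ (pImp (eqr b a') (pImp (eqr b' a) (eqr b b')))).
  { rintro Hb. rintro Hb'. rapply2 (Htr b a' b'); [ruse Hb|].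
    rapply2 (Htr a' a b'); [rapply (Hsym a a'); ruse Haa|rapply (Hsym b' a); ruse Hb']. }
  intros ? Hfin.
  eapply r_case; [rapply2 (He p s' t' t); [ruse Hp'|rapply (Hur p s0 t); ruse Hp]| |]; intros ? Hq.
  - rhave (eqr b a') as Hb; [rapply2 (Hsg s' a' b); [ruse Hs'|]; rapply2 (Hr b t s'); [ruse Hq|ruse Hbt]|].
    eapply r_case; [rapply2 (He p s0 t t'); [ruse Hp|rapply (Hur p s' t'); ruse Hp']| |]; intros ? Hq'.
    + rapply2 Hfin; [ruse Hb|]. rapply2 (Hsg s0 a b'); [ruse Hs|].
      rapply2 (Hr b' t' s0); [ruse Hq'|ruse Hbt'].
    + rapply2 (Htr b a' b'); [ruse Hb|]. rapply (Hsym b' a'). rapply2 (Hsg s' a' b'); [ruse Hs'|].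
      rapply2 (Hr b' t s'); [ruse Hq|]. rapply2 (Hr b' t' t); [ruse Hq'|ruse Hbt'].
  - eapply r_case; [rapply2 (He t' a' b' b); [ruse Ht'|rapply2 (Hr b t t'); [ruse Hq|ruse Hbt]]| |];
      intros ? Hb; [|ruse Hb].
    eapply r_case; [rapply2 (He t a b b'); [ruse Ht|]; rapply2 (Hr b' t' t); [rapply (Hsym t t'); ruse Hq|ruse Hbt']
      | |]; intros ? Hb'.
    + rapply2 Hfin; [ruse Hb|ruse Hb'].
    + rapply (Hsym b' b). ruse Hb'.
Qed.

(** * Subcountability in the model *)

Definition eqv (x y : V) : Prop := exists v, eqr x y v.

Lemma eqv_sym x y : eqv x y -> eqv y x.
Proof.
  intros [v Hv]. destruct eqr_sym as [t Ht]. destruct (Ht vtt) as (f & _ & Hf).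
  destruct (Hf x y v Hv) as (w & _ & Hw). now exists w.
Qed.

Lemma eqv_elt x y i : eqv x y -> ix x i -> exists j, ix y j /\ eqv (elt x i) (elt y j).
Proof.
  intros [v Hv] Hi. apply eqr_unfold in Hv as (a & b & -> & Ha & _).
  destruct (Ha i i (conj eq_refl Hi)) as (c & _ & j & ? & q & _ & [_ Hj] & Hq).
  exists j. split; [exact Hj|now exists q].
Qed.

Lemma numV_elt n i : ix (numV (numeral n)) i ->
  exists m, m < n /\ elt (numV (numeral n)) i = numV (numeral m).
Proof.
  revert i. induction n as [|n IH]; cbn; [easy|]. intros i [(j & -> & Hj)| ->].
  - destruct (IH j Hj) as (m & Hm & E). exists m. auto.
  - exists n. auto.
Qed.

Lemma numV_lt m n : m < n ->
  exists i, ix (numV (numeral n)) i /\ elt (numV (numeral n)) i = numV (numeral m).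
Proof.
  induction 1 as [|n _ (i & Hi & E)]; cbn.
  - exists (vinr vtt). auto.
  - exists (vinl i). eauto.
Qed.

(** The smaller of two distinct numbers would be an element of the larger, hence equal to an element
    of itself, against the induction hypothesis. *)
Lemma numV_inj n : forall m, eqv (numV (numeral n)) (numV (numeral m)) -> n = m.
Proof.
  induction n as [n IH] using (well_founded_ind lt_wf). intros m H.
  destruct (lt_eq_lt_dec n m) as [[Hlt|E]|Hlt]; [exfalso|exact E|exfalso].
  - destruct (numV_lt _ _ Hlt) as (i & Hi & E).
    destruct (eqv_elt _ _ _ (eqv_sym _ _ H) Hi) as (j & Hj & Hq).
    destruct (numV_elt _ _ Hj) as (k & Hk & Ek). rewrite E, Ek in Hq.
    apply eqv_sym, (IH k Hk) in Hq. lia.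
  - destruct (numV_lt _ _ Hlt) as (i & Hi & E).
    destruct (eqv_elt _ _ _ H Hi) as (j & Hj & Hq).
    destruct (numV_elt _ _ Hj) as (k & Hk & Ek). rewrite E, Ek in Hq.
    apply (IH m Hlt) in Hq. lia.
Qed.

Definition pMaps (f a b : V) : pred := pEx (fun p => pAnd (memr p f) (pOpair p a b)).

Definition pSurj (f U x : V) : pred :=
  pAnd (pAll (fun p => pImp (memr p f) (pEx (fun n => pEx (fun y =>
    pAnd (memr n U) (pAnd (memr y x) (pOpair p n y)))))))
  (pAnd (pAll (fun n => pImp (memr n U) (pEx (fun y => pAnd (memr y x) (pMaps f n y)))))
  (pAnd (pAll (fun n => pAll (fun y => pAll (fun z =>
    pImp (pMaps f n y) (pImp (pMaps f n z) (eqr y z))))))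
  (pAll (fun y => pImp (memr y x) (pEx (fun n => pAnd (memr n U) (pMaps f n y))))))).

(** Indices can be coded by numbers, unlike elements. An element with several indices gets several
    numbers, so [countingV x] need not be injective. *)
Definition indexV (i : val) : V := numV (numeral (val_code i)).
Definition indicesV (x : V) : V := mkV (ix x) indexV.
Definition countingV (x : V) : V := mkV (ix x) (fun i => opairV (indexV i) (elt x i)).

Lemma subcountable_valid : valid (pAll (fun x => pEx (fun U =>
  pAnd (pAll (fun n => pImp (memr n U) (pN n))) (pEx (fun f => pSurj f U x))))).
Proof.
  valid_with eqr_refl. valid_with eqr_sym. valid_with eqr_trans.
  valid_with omega_valid. valid_with opair_valid. valid_with opair_eqr.
  valid_with opair_eqr_fst. valid_with opair_eqr_snd. valid_with opair_fst_valid.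
  valid_with opair_snd_valid. valid_start. rintro Hsnd. rintro Hfst. rintro Hp2. rintro Hp1.
  rintro Hp0. rintro Hop. rintro Ho. rintro Htr. rintro Hsym. rintro Hrefl. rall x.
  apply (r_ex (indicesV x)), r_and.
  { rall n. rintro (i & ? & ? & -> & [-> Hi] & Hq). apply (r_ex omegaV), r_and; [ruse Ho|].
    (* [Quote] computes this numeral from [i]. *)
    rmem (numeral (val_code i)); [now eexists|]. ruse Hq. }
  apply (r_ex (countingV x)), r_and; [|apply r_and; [|apply r_and]].
  - rall p. rintro (i & ? & ? & -> & [-> Hi] & Hq).
    apply (r_ex (indexV i)), (r_ex (elt x i)), r_and; [|apply r_and].
    + rmem i; [exact Hi|]. ruse (Hrefl (indexV i)).
    + rmem i; [exact Hi|]. ruse (Hrefl (elt x i)).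
    + rapply2 (Hp0 (opairV (indexV i) (elt x i)) p (indexV i) (elt x i));
        [rapply (Hsym p (opairV (indexV i) (elt x i))); ruse Hq|ruse (Hop (indexV i) (elt x i))].
  - rall n. rintro (i & ? & ? & -> & [-> Hi] & Hq). apply (r_ex (elt x i)), r_and.
    + rmem i; [exact Hi|]. ruse (Hrefl (elt x i)).
    + apply (r_ex (opairV (indexV i) (elt x i))), r_and.
      * rmem i; [exact Hi|]. ruse (Hrefl (opairV (indexV i) (elt x i))).
      * rapply2 (Hp1 (opairV (indexV i) (elt x i)) (indexV i) n (elt x i));
          [rapply (Hsym n (indexV i)); ruse Hq|ruse (Hop (indexV i) (elt x i))].
  - rall n. rall y. rall z.
    rintro (p & ? & ? & -> & (i & ? & ? & -> & [-> Hi] & Hq) & Hy).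
    rintro (p' & ? & ? & -> & (j & ? & ? & -> & [-> Hj] & Hq') & Hz).
    rhave (pOpair p (indexV i) (elt x i)) as Hpi.
    { rapply2 (Hp0 (opairV (indexV i) (elt x i)) p (indexV i) (elt x i));
        [rapply (Hsym p (opairV (indexV i) (elt x i))); ruse Hq|ruse (Hop (indexV i) (elt x i))]. }
    rhave (pOpair p' (indexV j) (elt x j)) as Hpj.
    { rapply2 (Hp0 (opairV (indexV j) (elt x j)) p' (indexV j) (elt x j));
        [rapply (Hsym p' (opairV (indexV j) (elt x j))); ruse Hq'|ruse (Hop (indexV j) (elt x j))]. }
    rhave (eqr (indexV i) (indexV j)) as E.
    { rapply2 (Htr (indexV i) n (indexV j)).
      - rapply2 (Hfst p (indexV i) (elt x i) n y); [ruse Hpi|ruse Hy].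
      - rapply2 (Hfst p' n z (indexV j) (elt x j)); [ruse Hz|ruse Hpj]. }
    (* Equal numbers stem from the same index by injectivity of the coding, so both pairs have the
       same second component. *)
    assert (i = j) as <-.
    { apply val_code_inj, numV_inj. eexists. exact E. }
    rapply2 (Htr y (elt x i) z).
    + rapply2 (Hsnd p n y (indexV i) (elt x i)); [ruse Hy|ruse Hpi].
    + rapply2 (Hsnd p' (indexV i) (elt x i) n z); [ruse Hpj|ruse Hz].
  - rall y. rintro (i & ? & ? & -> & [-> Hi] & Hq). apply (r_ex (indexV i)), r_and.
    + rmem i; [exact Hi|]. ruse (Hrefl (indexV i)).
    + apply (r_ex (opairV (indexV i) (elt x i))), r_and.
      * rmem i; [exact Hi|]. ruse (Hrefl (opairV (indexV i) (elt x i))).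
      * rapply2 (Hp2 (opairV (indexV i) (elt x i)) (indexV i) (elt x i) y);
          [rapply (Hsym y (elt x i)); ruse Hq|ruse (Hop (indexV i) (elt x i))].
Qed.

Lemma valid_ext {I} (P Q : I -> pred) : (forall i, P i = Q i) -> valid (pAll Q) -> valid (pAll P).
Proof. intro E. apply functional_extensionality in E. now rewrite E. Qed.

Lemma valid_sentence p : sentence p -> valid (rsem p (fun _ => emptyV)) -> valid (pAll (rsem p)).
Proof.
  intros Hp [t Ht]. exists t. intro s. rall r.
  rewrite (sem_ext_bound rint p r (fun _ => emptyV)); [apply Ht|].
  unfold sentence in Hp. lia.
Qed.

Lemma CZF_realized p : CZF p -> exists t, forall s r, realizes s t (rsem p r).
Proof.
  intros [| | |q Hq| |q|q|q]; apply realized_axiom.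
  - apply valid_sentence; [reflexivity|exact ext_valid].
  - apply valid_sentence; [reflexivity|]. valid_with upair_valid. valid_start. rintro H. rall a. rall b.
    apply (r_ex (upairV a b)). ruse (H a b).
  - apply valid_sentence; [reflexivity|]. valid_with union_valid. valid_start. rintro H. rall a.
    apply (r_ex (unionV a)). ruse (H a).
  - apply valid_ext with (Q := fun r => pAll (fun a => pEx (fun b => pAll (fun y =>
      pIff (memr y b) (pAnd (memr y a) (rsem q (push y r)))))));
      [intro r; unfold pIff; sem_eq|].
    valid_with (sep_valid q). valid_start. rintro Hs. rall r. rall a.
    apply (r_ex (sepV a (fun z => rsem q (push z r)))). ruse (Hs r a).
  - apply valid_sentence; [reflexivity|]. valid_with omega_valid. valid_start. rintro H. apply (r_ex omegaV). ruse H.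
  - eapply valid_ext; [|exact (set_induction_valid q)]. intro r. sem_eq.
  - eapply valid_ext; [|exact (strong_collection_valid q)]. intro r. unfold pFull. sem_eq.
  - eapply valid_ext; [|exact (subset_collection_valid q)]. intro r. unfold pFull. sem_eq.
Qed.

Lemma base_realized p : base p -> exists t, forall s r, realizes s t (rsem p r).
Proof.
  intros [H|[[]|[q]]].
  - now apply CZF_realized.
  - apply realized_axiom, valid_sentence; [reflexivity|exact subcountable_valid].
  - apply realized_axiom. eapply valid_ext; [|exact (uniformity_valid q)].
    intro r. unfold pN, pOmega, pIff, pEmpty, pSucc. sem_eq.
Qed.

Theorem theorem2p5 :
  (forall (k : kind) (X le : form),
      proves (union CZF (union SC UP)) (proper_class_claim k X le)) /\
  (forall (k : kind) (X le : form), ~ proves CZF (set_carrier_claim k X le)) /\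
  (forall T : theory,
      (forall p : form, T p -> sentence p) ->
      (forall p : form, CZF p -> proves T p) ->
      consistent (union T (union SC UP)) ->
      forall (k : kind) (X le : form), ~ proves T (set_carrier_claim k X le)).

Proof.
  split; [exact proper_class|]. split; [|exact no_set_carrier].
  intros k X le. apply no_set_carrier.
  - intros p H. apply base_sentence. now left.
  - intros p H. exists [p]. split; [now intros q [<-|[]]|]. apply d_hyp. now left.
  - exact (consistent_of_realized _ base_realized).
Qed.
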